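(* Let $\mathcal{N}^{A'\to BE}$ be a quantum wiretap channel with qubit input $A'$, let $z\mapsto\rho_z^{A'}$ ($z\in\{0,1\}$) be a choice of two input states, and let $0<\beta<1/2$. For $N=2^n$ consider the private polar coding scheme of block length $N$, with input bits $U^N=(U_1,\dots,U_N)$ uniformly distributed on $\{0,1\}^N$, and let $U_{\mathcal{A}}$ denote the information bits, i.e. the bits of $U^N$ indexed by $\mathcal{A}$. Then, for sufficiently large $N$, the scheme satisfies the strong security criterion $$I(U_{\mathcal{A}};E^N)=o\bigl(2^{-\frac12N^\beta}\bigr),$$ where $E^N$ denotes the wiretapper's $N$ channel output systems.
   Context: Basic quantities. A binary-input classical-quantum (cq) channel $W:x\mapsto\rho_x$ assigns to each bit $x\in\{0,1\}$ a density operator $\rho_x$. Its fidelity is $F(W)=\|\sqrt{\rho_0}\sqrt{\rho_1}\|_1^2$. The von Neumann entropy is $H(\sigma)=-\mathrm{Tr}\{\sigma\log_2\sigma\}$, and $I(X;Y)=H(X)+H(Y)-H(XY)$ is the quantum mutual information. Wiretap channel. A quantum wiretap channel $\mathcal{N}^{A'\to BE}$ is a completely positive trace-preserving map from a qubit $A'$ to systems $B$ (legitimate receiver) and $E$ (wiretapper); $\mathcal{N}^{A'\to B}=\mathrm{Tr}_E\circ\mathcal{N}^{A'\to BE}$ and $\mathcal{N}^{A'\to E}=\mathrm{Tr}_B\circ\mathcal{N}^{A'\to BE}$. Let $U_{\mathcal N}^{A'\to BES_2}$ be an isometric extension of $\mathcal{N}^{A'\to BE}$ with environment $S_2$. Fix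 input states $\rho_z^{A'}$, $z\in\{0,1\}$, with purifications $|\psi_z\rangle^{A'S_1}$. Amplitude channel to Bob: $W_{A,B}:z\mapsto\mathcal{N}^{A'\to B}(\rho_z^{A'})$. Phase channel to Bob: with $|\varphi\rangle^{CA'S_1}=\frac1{\sqrt2}\sum_{z}|z\rangle^C|\psi_z\rangle^{A'S_1}$ and $Z$ the Pauli phase operator, $W_{P,B}:x\mapsto\omega_x^{BCS_1S_2}=\mathrm{Tr}_E\{U_{\mathcal N}(Z^x)^C|\varphi\rangle\langle\varphi|(Z^x)^C U_{\mathcal N}^\dagger\}$. Synthesized channels. Let $N=2^n$ and let $G_N$ be Arikan's $N\times N$ encoding matrix over $\mathbb{F}_2$, $G_N=R_NK^{\otimes n}$ with $K=\begin{pmatrix}1&0\\1&1\end{pmatrix}$ and $R_N$ the bit-reversal permutation matrix; bit strings are row vectors. For a cq channel $W:x\mapsto\rho_x$ write $\rho_{x^N}=\rho_{x_1}\otimes\cdots\otimes\rho_{x_N}$. The $i$-th synthesized amplitude channel $W_{A,B,N}^{(i)}$ (with $\rho_x$ the outputs of $W_{A,B}$) is $$u_i\mapsto\sum_{u_1^{i-1}}\frac1{2^{i-1}}|u_1^{i-1}\rangle\langle u_1^{i-1}|\otimes\sum_{u_{i+1}^N}\frac1{2^{N-i}}\rho_{u^NG_N},$$ i.e. previous bits are available and future bits are uniformly random. The $i$-th synthesized phase channel $W_{P,B,N}^{(i)}$ uses $G_N^T$ in place of $G_N$, with future bits available and previous bits uniformly random: $$x_i\mapsto\sum_{x_{i+1}^N}\frac1{2^{N-i}}|x_{i+1}^N\rangle\langle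 x_{i+1}^N|\otimes\sum_{x_1^{i-1}}\frac1{2^{i-1}}\omega_{x^NG_N^T}$$ (up to an input-independent unitary on $C^N$, which does not affect fidelities). Index sets. Let $\mathcal{G}_N(W_{A,B},\beta)=\{i\in[N]:\sqrt{F(W_{A,B,N}^{(i)})}<2^{-N^\beta}\}$, $\mathcal{G}_N(W_{P,B},\beta)=\{i\in[N]:\sqrt{F(W_{P,B,N}^{(i)})}<2^{-N^\beta}\}$, and let $\mathcal{B}_N(\cdot,\beta)=[N]\setminus\mathcal{G}_N(\cdot,\beta)$. Define $\mathcal{A}=\mathcal{G}_N(W_{A,B},\beta)\cap\mathcal{G}_N(W_{P,B},\beta)$, $\mathcal{X}=\mathcal{G}_N(W_{A,B},\beta)\cap\mathcal{B}_N(W_{P,B},\beta)$, $\mathcal{Z}=\mathcal{B}_N(W_{A,B},\beta)\cap\mathcal{G}_N(W_{P,B},\beta)$, $\mathcal{B}=\mathcal{B}_N(W_{A,B},\beta)\cap\mathcal{B}_N(W_{P,B},\beta)$. Scheme. The private polar coding scheme sends information bits through the inputs in $\mathcal{A}$, random bits through $\mathcal{X}$, frozen bits (known to sender and receiver) through $\mathcal{Z}$, and secret-key bits shared by sender and receiver through $\mathcal{B}$; the input string $u^N$ is encoded as $u^NG_N$ and each bit $z$ of the result is sent as $\rho_z^{A'}$ over one use of $\mathcal{N}$. All of these bits are independent and uniform. Thus, writing $\sigma_z^E=\mathcal{N}^{A'\to E}(\rho_z^{A'})$ and $\sigma_{x^N}^{E^N}=\sigma_{x_1}\otimes\cdots\otimes\sigma_{x_N}$,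 the quantity $I(U_{\mathcal{A}};E^N)$ is evaluated on the state $2^{-N}\sum_{u^N}|u_{\mathcal{A}}\rangle\langle u_{\mathcal{A}}|\otimes\sigma^{E^N}_{u^NG_N}$. The asymptotic notation refers to $N=2^n\to\infty$ with $\mathcal{N}$, $\rho_z$, $\beta$ fixed. *)

(* Defs.v *)
From HB Require Import structures.
From mathcomp Require Import all_boot all_order all_algebra.
From mathcomp Require Import spectral complex mxtens.
From mathcomp Require Import all_classical all_reals all_analysis.

Set Implicit Arguments.
Unset Strict Implicit.
Unset Printing Implicit Defensive.

Import Order.TTheory GRing.Theory Num.Theory.
Import numFieldNormedType.Exports.
Local Open Scope ring_scope.
Local Open Scope sesquilinear_scope.

(* A finite-dimensional system is named by the finType labelling its
   computational basis; a composite system is labelled by the product type and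
   n copies of a system by {ffun 'I_n -> I}. Operators and kets are the
   library's matrices and column vectors, with the rows and columns numbered
   through enum_rank / enum_val. *)
Notation Lin R J I := 'M[R[i]]_(#|{: I%type}|, #|{: J%type}|).
Notation Op R I := 'M[R[i]]_(#|{: I%type}|).
Notation Ket R I := 'cV[R[i]]_(#|{: I%type}|).
Notation bit := 'F_2.

Definition entry (R : realType) (I J : finType) (A : Lin R J I) (x : I) (y : J)
  : R[i] := A (enum_rank x) (enum_rank y).

Definition of_entries (R : realType) (I J : finType) (f : I -> J -> R[i])
  : Lin R J I := \matrix_(k, l) f (enum_val k) (enum_val l).

Definition ket (R : realType) (I : finType) (x : I) : Ket R I :=
  delta_mx (enum_rank x) 0.

Definition ketbra (R : realType) (I : finType) (v : Ket R I) : Op R I :=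
  v *m v^t*.

Definition tens (R : realType) (I J K L : finType)
    (A : Lin R J I) (B : Lin R L K) : Lin R (J * L) (I * K) :=
  of_entries (fun x y => entry A x.1 y.1 * entry B x.2 y.2).

Definition tens_ket (R : realType) (I K : finType)
    (u : Ket R I) (v : Ket R K) : Ket R (I * K) :=
  \col_k (u (enum_rank (enum_val k).1) 0 * v (enum_rank (enum_val k).2) 0).

Definition tens_pow (R : realType) (I : finType) (N : nat)
    (A : 'I_N -> Op R I) : Op R {ffun 'I_N -> I} :=
  of_entries (fun x y : {ffun 'I_N -> I} => \prod_k entry (A k) (x k) (y k)).

(* Partial trace over the system L, where the label [f x e] of the whole system
   is the one with parts x (kept) and e (traced out). *)
Definition ptrace (R : realType) (I K L : finType) (f : K -> L -> I)
    (A : Op R I) : Op R K :=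
  of_entries (fun x y => \sum_(e : L) entry A (f x e) (f y e)).

Definition ptrace_l (R : realType) (I J : finType) (A : Op R (I * J))
  : Op R J := ptrace (fun y x => (x, y)) A.

Definition ptrace_r (R : realType) (I J : finType) (A : Op R (I * J))
  : Op R I := ptrace (fun x y => (x, y)) A.

(* [0 <= z] in R[i] means that z is real and nonnegative. *)
Definition psd (R : realType) (I : finType) (A : Op R I) : Prop :=
  forall v : Ket R I, 0 <= (v^t* *m A *m v) 0 0.

Definition density (R : realType) (I : finType) (A : Op R I) : Prop :=
  psd A /\ \tr A = 1.

Definition id_tens (R : realType) (I J : finType) (k : nat)
    (f : Op R I -> Op R J) (X : Op R ('I_k * I)) : Op R ('I_k * J) :=
  of_entries (fun p q =>
    entry (f (of_entries (fun x y => entry X (p.1, x) (q.1, y)))) p.2 q.2).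

Definition cptp (R : realType) (I J : finType) (f : Op R I -> Op R J) : Prop :=
  [/\ linear f,
      forall (k : nat) (X : Op R ('I_k * I)), psd X -> psd (id_tens f X) &
      forall X : Op R I, \tr (f X) = \tr X].

Definition isometric_extension (R : realType) (I J S : finType)
    (U : Lin R I (J * S)) (f : Op R I -> Op R J) : Prop :=
  U^t* *m U = 1%:M /\ forall X : Op R I, f X = ptrace_r (U *m X *m U^t*).

Definition purification (R : realType) (I S : finType) (psi : Ket R (I * S))
    (rho : Op R I) : Prop := ptrace_r (ketbra psi) = rho.

(* Functional calculus; only meaningful for a Hermitian A. *)
Definition mxfun (R : realType) (n : nat) (f : R -> R) (A : 'M[R[i]]_n)
  : 'M[R[i]]_n :=
  invmx (spectralmx A) *m
  diag_mx (map_mx (fun z => (f (complex.Re z))%:C%C) (spectral_diag A)) *m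
  spectralmx A.

Definition trnorm (R : realType) (n : nat) (A : 'M[R[i]]_n) : R :=
  complex.Re (\tr (mxfun Num.sqrt (A^t* *m A))).

(* [ln 0 = 0], which implements the convention 0 log 0 = 0 in the entropy. *)
Definition log2 (R : realType) (x : R) : R := ln x / ln 2.

Definition entropy (R : realType) (n : nat) (A : 'M[R[i]]_n) : R :=
  - complex.Re (\tr (A *m mxfun (@log2 R) A)).

Definition mutual_info (R : realType) (I J : finType) (A : Op R (I * J)) : R :=
  entropy (ptrace_r A) + entropy (ptrace_l A) - entropy A.

Definition fidelity (R : realType) (I : finType) (W : bit -> Op R I) : R :=
  trnorm (mxfun Num.sqrt (W 0) *m mxfun Num.sqrt (W 1)) ^+ 2.

Definition polar_kernel : 'M[bit]_2 := \matrix_(r, c) (c <= r)%N%:R.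

Fixpoint kron_pow (n : nat) : 'M[bit]_(2 ^ n) :=
  if n is m.+1 then
    castmx (esym (expnS 2 m), esym (expnS 2 m)) (polar_kernel *t kron_pow m)
  else 1%:M.

Definition bit_reverse (n r : nat) : nat :=
  \sum_(k < n) odd (r %/ 2 ^ k) * 2 ^ (n.-1 - k).

Definition reverse_mx (n : nat) : 'M[bit]_(2 ^ n) :=
  \matrix_(r, c) ((c : nat) == bit_reverse n r)%:R.

Definition polar_mx (n : nat) : 'M[bit]_(2 ^ n) := reverse_mx n *m kron_pow n.

(* The output of N uses of the cq channel W on the bit string x. *)
Definition outputs (R : realType) (I : finType) (N : nat)
    (W : bit -> Op R I) (x : 'rV[bit]_N) : Op R {ffun 'I_N -> I} :=
  tens_pow (fun k => W (x 0 k)).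

(* Positions are numbered from 0, so i bits precede position i and N - i.+1
   bits follow it. *)
Definition bit_string (N : nat) (i : 'I_N) (a : i.-tuple bit) (u : bit)
    (b : (N - i.+1).-tuple bit) : 'rV[bit]_N :=
  \row_j nth 0 (a ++ u :: b) j.

Definition synth_amplitude (R : realType) (I : finType) (n : nat)
    (W : bit -> Op R I) (i : 'I_(2 ^ n)) (u : bit)
  : Op R (i.-tuple bit * {ffun 'I_(2 ^ n) -> I}) :=
  \sum_(a : i.-tuple bit) 2 ^- i *:
    tens (ketbra (ket R a))
      (\sum_(b : (2 ^ n - i.+1).-tuple bit) 2 ^- (2 ^ n - i.+1) *:
         outputs W (bit_string a u b *m polar_mx n)).

Definition synth_phase (R : realType) (I : finType) (n : nat)
    (W : bit -> Op R I) (i : 'I_(2 ^ n)) (x : bit)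
  : Op R ((2 ^ n - i.+1).-tuple bit * {ffun 'I_(2 ^ n) -> I}) :=
  \sum_(b : (2 ^ n - i.+1).-tuple bit) 2 ^- (2 ^ n - i.+1) *:
    tens (ketbra (ket R b))
      (\sum_(a : i.-tuple bit) 2 ^- i *:
         outputs W (bit_string a x b *m (polar_mx n)^T)).

Definition pauliZ (R : realType) : Op R bit :=
  of_entries (fun z z' : bit => (z == z')%:R * (-1) ^+ (z : nat)).

Definition channel_bob (R : realType) (A B E : finType)
    (f : Op R A -> Op R (B * E)) (X : Op R A) : Op R B := ptrace_r (f X).

Definition channel_eve (R : realType) (A B E : finType)
    (f : Op R A -> Op R (B * E)) (X : Op R A) : Op R E := ptrace_l (f X).

Definition amplitude_bob (R : realType) (B E : finType)
    (f : Op R bit -> Op R (B * E)) (rho : bit -> Op R bit) (z : bit)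
  : Op R B := channel_bob f (rho z).

(* The ket on C A' S1. *)
Definition phase_input (R : realType) (S1 : finType)
    (psi : bit -> Ket R (bit * S1)) : Ket R (bit * (bit * S1)) :=
  (sqrtC 2)^-1 *: \sum_(z : bit) tens_ket (ket R z) (psi z).

(* U acts on A' only, so the untraced state lives on C ((B E) S2) S1. *)
Definition phase_bob (R : realType) (B E S1 S2 : finType)
    (U : Lin R bit (B * E * S2)) (psi : bit -> Ket R (bit * S1)) (x : bit)
  : Op R (B * bit * S1 * S2) :=
  ptrace
    (fun '(b, c, s1, s2) (e : E) => (c, (b, e, s2, s1)))
    (ketbra (tens (1%:M : Op R bit) (tens U (1%:M : Op R S1)) *m
           tens (pauliZ R ^+ (x : nat)) (1%:M : Op R (bit * S1)) *m
           phase_input psi)).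

Definition good_amplitude (R : realType) (I : finType) (n : nat)
    (W : bit -> Op R I) (beta : R) : {set 'I_(2 ^ n)} :=
  [set i | Num.sqrt (fidelity (synth_amplitude W i))
             < 2 `^ (- ((2 ^ n)%:R `^ beta))].

Definition good_phase (R : realType) (I : finType) (n : nat)
    (W : bit -> Op R I) (beta : R) : {set 'I_(2 ^ n)} :=
  [set i | Num.sqrt (fidelity (synth_phase W i))
             < 2 `^ (- ((2 ^ n)%:R `^ beta))].

Definition info_set (R : realType) (B E S1 S2 : finType)
    (f : Op R bit -> Op R (B * E)) (U : Lin R bit (B * E * S2))
    (rho : bit -> Op R bit) (psi : bit -> Ket R (bit * S1))
    (beta : R) (n : nat) : {set 'I_(2 ^ n)} :=
  (good_amplitude n (amplitude_bob f rho) beta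
     :&: good_phase n (phase_bob U psi) beta)%SET.

(* Joint state of the bits of u indexed by A (in increasing order) and of the
   outputs of 2 ^ n uses of sigma, for u uniform and encoded as u G. *)
Definition wiretap_state (R : realType) (E : finType) (n : nat)
    (sigma : bit -> Op R E) (A : {set 'I_(2 ^ n)})
  : Op R ('rV[bit]_#|A| * {ffun 'I_(2 ^ n) -> E}) :=
  2 ^- (2 ^ n) *: \sum_(u : 'rV[bit]_(2 ^ n))
    tens (ketbra (ket R (colsub (@enum_val _ (mem A)) u)))
         (outputs sigma (u *m polar_mx n)).

(* Main.v *)
Require Import Defs.
From mathcomp Require Import all_boot all_order all_algebra.
From mathcomp Require Import spectral complex.
From mathcomp Require Import all_classical all_reals all_analysis.
From mathcomp Require mxtens.
From mathcomp Require Import ring lra.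

Set Implicit Arguments.
Unset Strict Implicit.
Unset Printing Implicit Defensive.

Import Order.TTheory GRing.Theory Num.Theory.
Import numFieldNormedType.Exports.
Local Open Scope ring_scope.
Local Open Scope sesquilinear_scope.

(** Purify: let [theta_z(q,e)] be the amplitudes of [U |psi_z>], with [e] a basis
    label of Eve's system and [q] one of everything else. Since [G] is an
    involution and [(x G^T).z = x.(z G)], the i-th synthesized phase channel to
    Bob is purified by giving Eve a copy of the first [i] bits of [u = z G], and
    its two outputs differ by the sign [(-1)^(u_i)]. The easy half of Uhlmann's
    theorem then bounds the bias that any contraction on Eve's side, controlled
    by the bits preceding [u_i], has towards [u_i] by [sqrt F] of that phase
    channel, so on the phase-good positions it is below [2^(-N^beta)].

    Resampling the bits of [u] one at a time turns the state of [(U_A, E^N)] into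
    the product of its marginals, so these two are at trace distance at most
    [N 2^(-N^beta)]. A Fannes-type bound for the entropy, whose dimension factor
    costs only [O(N)], gives [I(U_A; E^N) = O(N^2 2^(-N^beta))]. *)

(** * Spectral calculus and contractions *)

(** Trace distance enters only through tests: two states are close when no contraction [V] separates
    the values [Re (tr (V X))]. This form survives conditioning: a joint test on the bits and on
    Eve's system has one corner per value of the bits, each again a contraction, and differences of
    corners become tests on Eve alone.

    The order of resampling is dictated by the phase channel. Position [i] randomizes the phases
    that precede it, which leaves Eve a copy of exactly the earlier bits of [u]; so hybrid [j] keeps
    the true bits before [j] and takes fresh ones from [j] on, and the test at step [j] may depend
    on [u] through that prefix only.

    The entropy bound must tolerate a dimension exponential in [N]. Both states are compared with a
    common upper bound, through [1 - 1/t <= ln t] in pairs of eigenbases, and the dimension enters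
    only as [n * expR (- L)] with [L] free; [L = N ln (4 (|E| + 1))] brings this term below
    [2^(-N)]. *)

Section SquaredNorm.
Variable R : realType.
Local Notation C := R[i].
Local Notation Re := complex.Re.

(** The modulus in [R[i]] is itself complex; its real part lets the estimates live in the ordered
    field [R]. *)
Definition sqn (z : C) : R := Re (`|z| ^+ 2).

Lemma sqnE (z : C) : (sqn z)%:C%C = `|z| ^+ 2.
Proof. by rewrite /sqn RRe_real // realX // normr_real. Qed.

Lemma sqn_ge0 (z : C) : 0 <= sqn z.
Proof. by rewrite -lecR sqnE exprn_ge0. Qed.

Lemma sqn_sum_squares (z : C) : sqn z = Re z ^+ 2 + complex.Im z ^+ 2.
Proof. by rewrite /sqn -add_Re2_Im2. Qed.

Lemma sqn_eq0 (z : C) : (sqn z == 0) = (z == 0).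
Proof. by rewrite -(inj_eq (@complexI R)) sqnE expf_eq0 normr_eq0. Qed.

Lemma sqn0 : sqn 0 = 0.
Proof. by apply/eqP; rewrite sqn_eq0. Qed.

Lemma sqn1 : sqn 1 = 1.
Proof. by apply: (@complexI R); rewrite sqnE normr1 expr1n. Qed.

Lemma sqnM (y z : C) : sqn (y * z) = sqn y * sqn z.
Proof. by apply: (@complexI R); rewrite rmorphM /= !sqnE normrM exprMn. Qed.

Lemma sqnC (z : C) : sqn z^* = sqn z.
Proof. by apply: (@complexI R); rewrite !sqnE norm_conjC. Qed.

Lemma sqnK (z : C) : z * z^* = (sqn z)%:C%C.
Proof. by rewrite sqnE normCK. Qed.

Lemma sqn_real (x : R) : sqn x%:C%C = x ^+ 2.
Proof. by rewrite sqn_sum_squares /= expr0n addr0. Qed.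

Lemma re_sum (I : Type) (r : seq I) (P : pred I) (F : I -> C) :
  Re (\sum_(i <- r | P i) F i) = \sum_(i <- r | P i) Re (F i).
Proof. by elim/big_rec2: _ => //= i y1 y2 _ <-; case: (F i) y2 => ? ? []. Qed.

Lemma reD (y z : C) : Re (y + z) = Re y + Re z.
Proof. by case: y z => ? ? []. Qed.

Lemma reN (z : C) : Re (- z) = - Re z.
Proof. by case: z. Qed.

Lemma reZ (x : R) (z : C) : Re (x%:C%C * z) = x * Re z.
Proof. by case: z => a b /=; rewrite mul0r subr0. Qed.

Lemma re_mul_le (x y : C) : 2 * Re (x * y) <= sqn x + sqn y.
Proof.
rewrite !sqn_sum_squares; case: x y => [a b] [c d] /=.
have := sqr_ge0 (a - c); have := sqr_ge0 (b + d).
rewrite sqrrD sqrrB; nra.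
Qed.

(** Cauchy-Schwarz with the bound [s] supplied from outside: it follows from
    [2 Re (x y) <= |x|^2 + |y|^2] after rescaling, so no square root of a sum appears. *)
Lemma re_mul_sum_le (I : finType) (x y : I -> C) (s : R) :
  0 <= s -> \sum_i sqn (x i) <= 1 -> \sum_i sqn (y i) <= s ^+ 2 ->
  Re (\sum_i x i * y i) <= s.
Proof.
move=> s0 hx hy; apply/ler_addgt0Pr => e e0.
(* Rescaling [x] by [t] makes both sums at most [t ^+ 2]; the slack [e] keeps [t] positive when
   [s = 0]. *)
set t := s + e.
have t0 : 0 < t by rewrite ltr_wpDl.
have ts : s <= t by rewrite lerDl ltW.
suff H : 2 * (t * Re (\sum_i x i * y i)) <= 2 * (t * t).
  by move: H; rewrite ler_pM2l // ler_pM2l.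
have -> : 2 * (t * Re (\sum_i x i * y i)) =
    \sum_i 2 * Re ((t%:C%C * x i) * y i).
  rewrite -mulr_sumr -re_sum -reZ mulr_sumr.
  by congr (_ * Re _); apply: eq_bigr => i _; rewrite mulrA.
apply: (@le_trans _ _ (\sum_i (t ^+ 2 * sqn (x i) + sqn (y i)))).
  by apply: ler_sum => i _; apply: le_trans (re_mul_le _ _) _; rewrite sqnM sqn_real.
rewrite big_split /= -mulr_sumr; nra.
Qed.

End SquaredNorm.

Section UnitaryConjugation.
Variable C : numClosedFieldType.

Lemma unitary_adjK n (P : 'M[C]_n) : P \is unitarymx -> P^t* *m P = 1%:M.
Proof. by move=> Pu; rewrite -invmx_unitary // mulVmx // unitarymx_unit. Qed.

Lemma unitary_mul_adj n (P Q : 'M[C]_n) :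
  P \is unitarymx -> Q \is unitarymx -> P *m Q^t* \is unitarymx.
Proof. by move=> Pu Qu; rewrite mul_unitarymx ?trmxC_unitary. Qed.

Lemma conj_unitaryM n (P A B : 'M[C]_n) : P \is unitarymx ->
  (P^t* *m A *m P) *m (P^t* *m B *m P) = P^t* *m (A *m B) *m P.
Proof. by move=> Pu; rewrite !mulmxA mulmxtVK. Qed.

(** Equality of two diagonalizations becomes an intertwining relation for the overlap matrix
    [Q *m P^t*], which can be read off entry by entry. *)
Lemma conj_unitary_intertwine n (P Q A B : 'M[C]_n) :
  P \is unitarymx -> Q \is unitarymx ->
  Q^t* *m A *m Q = P^t* *m B *m P <-> A *m (Q *m P^t* ) = Q *m P^t* *m B.
Proof.
move=> Pu Qu; split=> [H|H].
  transitivity (Q *m (Q^t* *m A *m Q) *m P^t* ).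
    by rewrite !mulmxA (unitarymxP Qu) mul1mx.
  by rewrite H !mulmxA mulmxtVK.
transitivity (Q^t* *m (A *m (Q *m P^t* )) *m P).
  by rewrite !mulmxA -[RHS]mulmxA unitary_adjK // mulmx1.
by rewrite H !mulmxA unitary_adjK // mul1mx.
Qed.

Lemma tr_diag_sandwich n (T : 'M[C]_n) (d e : 'rV[C]_n) :
  \tr (diag_mx d *m (T *m (diag_mx e *m T^t* ))) =
  \sum_i \sum_j d 0 i * e 0 j * (T i j * (T i j)^* ).
Proof.
rewrite /mxtrace; apply: eq_bigr => i _.
rewrite mul_diag_mx mxE [X in _ * X]mxE mulr_sumr; apply: eq_bigr => j _.
by rewrite mul_diag_mx !mxE -!mulrA; congr (_ * _); rewrite mulrCA.
Qed.

Lemma tr_conj_diag n (P Q : 'M[C]_n) (d e : 'rV[C]_n) :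
  \tr ((P^t* *m diag_mx d *m P) *m (Q^t* *m diag_mx e *m Q)) =
  \sum_i \sum_j d 0 i * e 0 j * ((P *m Q^t* ) i j * ((P *m Q^t* ) i j)^* ).
Proof.
set T := P *m Q^t*.
have -> : (P^t* *m diag_mx d *m P) *m (Q^t* *m diag_mx e *m Q) =
          P^t* *m (diag_mx d *m (T *m diag_mx e) *m Q).
  by rewrite /T !mulmxA.
rewrite mxtrace_mulC -!mulmxA.
have -> : Q *m P^t* = T^t* by rewrite /T trmx_mul map_mxM trmxCK.
rewrite [P *m (_ *m _)]mulmxA -/T; exact: tr_diag_sandwich.
Qed.

Lemma quad_conj_diag n (P : 'M[C]_n) (d : 'rV[C]_n) (v : 'cV[C]_n) :
  (v^t* *m (P^t* *m diag_mx d *m P) *m v) 0 0 =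
  \sum_i d 0 i * ((P *m v) i 0 * ((P *m v) i 0)^* ).
Proof.
have -> : v^t* *m (P^t* *m diag_mx d *m P) *m v =
          (P *m v)^t* *m (diag_mx d *m (P *m v)).
  by rewrite trmx_mul map_mxM !mulmxA.
rewrite mxE; apply: eq_bigr => i _.
by rewrite mul_diag_mx !mxE mulrC -mulrA.
Qed.

End UnitaryConjugation.

Section LinearAlgebra.
Variable R : realType.
Local Notation C := R[i].
Local Notation Re := complex.Re.

Lemma adjM m n p (A : 'M[C]_(m, n)) (B : 'M[C]_(n, p)) :
  (A *m B)^t* = B^t* *m A^t*.
Proof. by rewrite trmx_mul map_mxM. Qed.

Lemma adjD m n (A B : 'M[C]_(m, n)) : (A + B)^t* = A^t* + B^t*.
Proof. by rewrite linearD map_mxD. Qed.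

Lemma adjB m n (A B : 'M[C]_(m, n)) : (A - B)^t* = A^t* - B^t*.
Proof. by rewrite linearB map_mxB. Qed.

Lemma adjE m n (A : 'M[C]_(m, n)) i j : A^t* i j = (A j i)^*.
Proof. by rewrite !mxE. Qed.

Definition rdiag n (d : 'rV[R]_n) : 'M[C]_n :=
  diag_mx (map_mx (real_complex R) d).

(** For unitary [P], a Hermitian matrix presented by some eigenbasis and a real spectrum, not tied
    to the choice made by [spectralmx]. *)
Definition udiag n (P : 'M[C]_n) (d : 'rV[R]_n) : 'M[C]_n :=
  P^t* *m rdiag d *m P.

Lemma rdiag_adj n (d : 'rV[R]_n) : (rdiag d)^t* = rdiag d.
Proof.
rewrite /rdiag tr_diag_mx map_diag_mx; congr diag_mx.
by apply/rowP => i; rewrite !mxE; apply/CrealP; rewrite complex_real.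
Qed.

Lemma udiag_adj n (P : 'M[C]_n) d : (udiag P d)^t* = udiag P d.
Proof. by rewrite /udiag !adjM trmxCK rdiag_adj mulmxA. Qed.

Lemma rdiagM n (a b : 'rV[R]_n) :
  rdiag a *m rdiag b = rdiag (\row_i (a 0 i * b 0 i)).
Proof.
rewrite /rdiag mulmx_diag; congr diag_mx.
by apply/rowP => i; rewrite !mxE rmorphM.
Qed.

Lemma rdiagB n (a b : 'rV[R]_n) : rdiag (a - b) = rdiag a - rdiag b.
Proof. by rewrite /rdiag map_mxB raddfB. Qed.

Lemma udiagM n (P : 'M[C]_n) a b : P \is unitarymx ->
  udiag P a *m udiag P b = udiag P (\row_i (a 0 i * b 0 i)).
Proof.
by move=> Pu; rewrite /udiag (conj_unitaryM _ _ Pu) rdiagM.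
Qed.

Lemma udiagB n (P : 'M[C]_n) a b : udiag P (a - b) = udiag P a - udiag P b.
Proof. by rewrite /udiag rdiagB mulmxBr mulmxBl. Qed.

Lemma hermitian_udiag n (A : 'M[C]_n) : A^t* = A ->
  A = udiag (spectralmx A) (map_mx (@complex.Re R) (spectral_diag A)).
Proof.
move=> Ah; have Pu := spectral_unitarymx A.
have herm : A \is hermsymmx.
  by apply/is_hermitianmxP; rewrite expr0 scale1r Ah.
have /orthomx_spectralP := hermitian_normalmx herm.
rewrite /udiag (invmx_unitary Pu) => {1}->; congr mulmx; congr mulmx.
rewrite /rdiag; congr diag_mx; apply/rowP => i; rewrite !mxE RRe_real //.
by have /mxOverP := hermitian_spectral_diag_real herm.
Qed.

(** Where [T i j] is nonzero the hypothesis forces [a 0 i = b 0 j], and then [f] agrees on them. *)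
Lemma rdiag_intertwine n (T : 'M[C]_n) (a b : 'rV[R]_n) (f : R -> R) :
  rdiag a *m T = T *m rdiag b ->
  rdiag (map_mx f a) *m T = T *m rdiag (map_mx f b).
Proof.
move=> H; apply/matrixP => i j.
have /matrixP/(_ i j) := H; rewrite /rdiag !mul_diag_mx !mul_mx_diag !mxE.
have [->|T0] := eqVneq (T i j) 0; first by rewrite !mul0r !mulr0.
by rewrite [RHS]mulrC => /(mulIf T0)/complexI ->; rewrite mulrC.
Qed.

(** [mxfun] is built on the particular eigenbasis returned by [spectralmx]; intertwining shows that
    any other one gives the same matrix. *)
Lemma mxfun_udiag n (f : R -> R) (P : 'M[C]_n) d : P \is unitarymx ->
  mxfun f (udiag P d) = udiag P (map_mx f d).
Proof.
move=> Pu; set A := udiag P d; set Q := spectralmx A.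
set e := map_mx (@complex.Re R) (spectral_diag A).
have Qu : Q \is unitarymx := spectral_unitarymx A.
have AE : A = udiag Q e by apply: hermitian_udiag; rewrite udiag_adj.
have -> : mxfun f A = udiag Q (map_mx f e).
  rewrite /mxfun -/Q (invmx_unitary Qu) /udiag; congr mulmx; congr mulmx.
  by rewrite /rdiag; congr diag_mx; apply/rowP => i; rewrite !mxE.
apply/(conj_unitary_intertwine _ _ Pu Qu).
by apply/rdiag_intertwine/(conj_unitary_intertwine _ _ Pu Qu).
Qed.

Lemma real_complex_sum (I : Type) (r : seq I) (P : pred I) (F : I -> R) :
  (\sum_(i <- r | P i) F i)%:C%C = \sum_(i <- r | P i) (F i)%:C%C :> C.
Proof. exact: rmorph_sum. Qed.

Lemma re_tr_udiagM n (P Q : 'M[C]_n) a b :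
  Re (\tr (udiag P a *m udiag Q b)) =
  \sum_i \sum_j a 0 i * b 0 j * sqn ((P *m Q^t* ) i j).
Proof.
rewrite /udiag /rdiag tr_conj_diag re_sum; apply: eq_bigr => i _.
rewrite re_sum; apply: eq_bigr => j _.
by rewrite sqnK !mxE -!rmorphM.
Qed.

Lemma re_tr_udiag n (P : 'M[C]_n) a : P \is unitarymx ->
  Re (\tr (udiag P a)) = \sum_i a 0 i.
Proof.
move=> Pu; rewrite /udiag mxtrace_mulC mulmxA (unitarymxP Pu) mul1mx.
by rewrite /rdiag mxtrace_diag re_sum; apply: eq_bigr => i _; rewrite !mxE.
Qed.

Lemma re_tr_mxfun n (P : 'M[C]_n) a f : P \is unitarymx ->
  Re (\tr (udiag P a *m mxfun f (udiag P a))) = \sum_i a 0 i * f (a 0 i).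
Proof.
move=> Pu; rewrite (mxfun_udiag _ _ Pu) (udiagM _ _ Pu) (re_tr_udiag _ Pu).
by apply: eq_bigr => i _; rewrite !mxE.
Qed.

Lemma unitary_row_sqn n (T : 'M[C]_n) i : T \is unitarymx ->
  \sum_j sqn (T i j) = 1.
Proof.
move=> /unitarymxP/matrixP/(_ i i); rewrite !mxE eqxx => H.
apply: (@complexI R); rewrite real_complex_sum -[RHS]H.
by apply: eq_bigr => j _; rewrite !mxE -sqnK.
Qed.

Lemma unitary_col_sqn n (T : 'M[C]_n) j : T \is unitarymx ->
  \sum_i sqn (T i j) = 1.
Proof.
rewrite -trmx_unitary => /(unitary_row_sqn j) <-.
by apply: eq_bigr => i _; rewrite mxE.
Qed.

Definition quad n (A : 'M[C]_n) (v : 'cV[C]_n) : R :=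
  Re ((v^t* *m A *m v) 0 0).

Lemma quadD n (A B : 'M[C]_n) v : quad (A + B) v = quad A v + quad B v.
Proof. by rewrite /quad mulmxDr mulmxDl mxE reD. Qed.

Lemma quadB n (A B : 'M[C]_n) v : quad (A - B) v = quad A v - quad B v.
Proof. by rewrite /quad mulmxBr mulmxBl !mxE reD reN. Qed.

Lemma quad_udiag n (P : 'M[C]_n) a v :
  quad (udiag P a) v = \sum_i a 0 i * sqn ((P *m v) i 0).
Proof.
rewrite /quad /udiag /rdiag quad_conj_diag re_sum.
by apply: eq_bigr => i _; rewrite sqnK !mxE -rmorphM.
Qed.

(** Hermiticity is demanded separately because [quad] sees only the real part of the form. *)
Definition posmx n (A : 'M[C]_n) : Prop :=
  A^t* = A /\ forall v, 0 <= quad A v.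

Lemma posmxD n (A B : 'M[C]_n) : posmx A -> posmx B -> posmx (A + B).
Proof.
move=> [Ah A0] [Bh B0]; split=> [|v]; first by rewrite adjD Ah Bh.
by rewrite quadD addr_ge0.
Qed.

Lemma posmx_udiag n (P : 'M[C]_n) (a : 'rV[R]_n) :
  (forall i, 0 <= a 0 i) -> posmx (udiag P a).
Proof.
move=> a0; split=> [|v]; first exact: udiag_adj.
by rewrite quad_udiag sumr_ge0 // => i _; rewrite mulr_ge0 ?sqn_ge0.
Qed.

Lemma quad_adj_unitary n (P : 'M[C]_n) a (y : 'cV[C]_n) : P \is unitarymx ->
  quad (udiag P a) (P^t* *m y) = \sum_i a 0 i * sqn (y i 0).
Proof. by move=> Pu; rewrite quad_udiag mulmxA (unitarymxP Pu) mul1mx. Qed.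

Lemma posmx_spectrum n (A : 'M[C]_n) : posmx A ->
  exists P, exists a, [/\ P \is unitarymx, A = udiag P a & forall i, 0 <= a 0 i].
Proof.
move=> [/hermitian_udiag AE A0]; set P := spectralmx A in AE.
set a := map_mx _ _ in AE; exists P, a.
have Pu : P \is unitarymx := spectral_unitarymx A.
split=> // i; have := A0 (P^t* *m delta_mx i 0).
rewrite AE (quad_adj_unitary _ _ Pu) (bigD1 i) //=.
rewrite [delta_mx _ _ _ _]mxE !eqxx sqn1 mulr1 big1 ?addr0 // => j /negbTE ji.
by rewrite [delta_mx _ _ _ _]mxE ji sqn0 mulr0.
Qed.

End LinearAlgebra.

Section Contractions.
Variable R : realType.
Local Notation C := R[i].
Local Notation Re := complex.Re.

Definition nrm2 n (v : 'cV[C]_n) : R := \sum_i sqn (v i 0).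

Definition contraction m n (K : 'M[C]_(m, n)) : Prop :=
  forall v, nrm2 (K *m v) <= nrm2 v.

Lemma nrm2_ge0 n (v : 'cV[C]_n) : 0 <= nrm2 v.
Proof. by rewrite sumr_ge0 // => i _; apply: sqn_ge0. Qed.

Lemma nrm2E n (v : 'cV[C]_n) : nrm2 v = Re ((v^t* *m v) 0 0).
Proof.
rewrite mxE re_sum; apply: eq_bigr => i _.
by rewrite !mxE mulrC sqnK.
Qed.

Lemma re_dot_le n (v w : 'cV[C]_n) :
  2 * Re ((v^t* *m w) 0 0) <= nrm2 v + nrm2 w.
Proof.
rewrite mxE re_sum mulr_sumr -big_split /=; apply: ler_sum => i _.
by apply: le_trans (re_mul_le _ _) _; rewrite !mxE sqnC.
Qed.

Lemma contraction_mul m n p (K : 'M[C]_(m, n)) (L : 'M[C]_(n, p)) :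
  contraction K -> contraction L -> contraction (K *m L).
Proof. by move=> Kc Lc v; rewrite -mulmxA (le_trans (Kc _)). Qed.

(** For [w = K^* v] one has [|w|^2 = Re <K w, v> <= (|K w|^2 + |v|^2) / 2 <= (|w|^2 + |v|^2) /
    2]. *)
Lemma contraction_adj m n (K : 'M[C]_(m, n)) :
  contraction K -> contraction (K^t* ).
Proof.
move=> Kc v; have E : nrm2 (K^t* *m v) = Re (((K *m (K^t* *m v))^t* *m v) 0 0).
  by rewrite nrm2E !adjM trmxCK !mulmxA.
have := re_dot_le (K *m (K^t* *m v)) v; have := Kc (K^t* *m v).
by rewrite -E; lra.
Qed.

Lemma nrm2_mxconj n (v : 'cV[C]_n) : nrm2 (map_mx Num.conj v) = nrm2 v.
Proof. by apply: eq_bigr => i _; rewrite mxE sqnC. Qed.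

Lemma contraction_tr m n (K : 'M[C]_(m, n)) :
  contraction K -> contraction K^T.
Proof.
move=> /contraction_adj Kc v; rewrite -nrm2_mxconj map_mxM.
by rewrite -(nrm2_mxconj v); apply: Kc.
Qed.

Lemma nrm2_unitary n (P : 'M[C]_n) v : P \is unitarymx ->
  nrm2 (P *m v) = nrm2 v.
Proof.
by move=> Pu; rewrite !nrm2E adjM -mulmxA [P^t* *m _]mulmxA unitary_adjK // mul1mx.
Qed.

Lemma contraction_unitary n (P : 'M[C]_n) :
  P \is unitarymx -> contraction P.
Proof. by move=> Pu v; rewrite nrm2_unitary. Qed.

Lemma contraction_rdiag n (d : 'rV[R]_n) :
  (forall i, d 0 i ^+ 2 <= 1) -> contraction (rdiag d).
Proof.
move=> d1 v; apply: ler_sum => i _; rewrite /rdiag mul_diag_mx !mxE.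
by rewrite sqnM sqn_real ler_piMl ?sqn_ge0.
Qed.

Lemma contraction_udiag n (P : 'M[C]_n) (d : 'rV[R]_n) : P \is unitarymx ->
  (forall i, d 0 i ^+ 2 <= 1) -> contraction (udiag P d).
Proof.
move=> Pu d1; apply: contraction_mul; last exact: contraction_unitary.
apply: contraction_mul; last exact: contraction_rdiag.
by apply: contraction_unitary; rewrite trmxC_unitary.
Qed.

(** In the hybrid argument [K] and [L] are the responses of a test to the two values of one bit, and
    their halved difference is the observable paired with the sign of that bit. The bound is
    convexity of the squared norm. *)
Lemma contraction_halfB m n (K L : 'M[C]_(m, n)) :
  contraction K -> contraction L -> contraction ((2^-1)%:C%C *: (K - L)).
Proof.
move=> Kc Lc v; have := Kc v; have := Lc v.
suff : nrm2 ((2^-1)%:C%C *: (K - L) *m v) <=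
       2^-1 * (nrm2 (K *m v) + nrm2 (L *m v)) by lra.
rewrite /nrm2 -big_split mulr_sumr; apply: ler_sum => i _ /=.
rewrite -scalemxAl mulmxBl !mxE sqnM sqn_real; set y := \sum_j _.
set x := \sum_j _; rewrite !sqn_sum_squares.
case: x y => [a b] [c d] /=.
have := sqr_ge0 (a + c); have := sqr_ge0 (b + d).
by rewrite !sqrrD !sqrrN !mulrN; nra.
Qed.

Lemma gram_udiag_col m n (A : 'M[C]_(m, n)) P d k : P \is unitarymx ->
  A^t* *m A = udiag P d -> nrm2 (col k (A *m P^t* )) = d 0 k.
Proof.
move=> Pu AE; have -> : d 0 k = Re ((P *m (A^t* *m A) *m P^t* ) k k).
  rewrite AE /udiag !mulmxA (unitarymxP Pu) mul1mx mulmxtVK // /rdiag.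
  by rewrite !mxE eqxx mulr1n.
rewrite -mulmxA -mulmxA mulmxA.
have -> : P *m A^t* = (A *m P^t* )^t* by rewrite adjM trmxCK.
rewrite mxE re_sum; apply: eq_bigr => i _.
by rewrite mxE adjE mulrC sqnK.
Qed.

Lemma quad_gram m n (M : 'M[C]_(n, m)) v : quad (M *m M^t* ) v = nrm2 (M^t* *m v).
Proof. by rewrite nrm2E /quad adjM trmxCK !mulmxA. Qed.

Lemma posmx_gram m n (M : 'M[C]_(n, m)) : posmx (M *m M^t* ).
Proof.
by split=> [|v]; [rewrite adjM trmxCK | rewrite quad_gram nrm2_ge0].
Qed.

Lemma gram_eq0 m n (M : 'M[C]_(n, m)) : M *m M^t* = 0 -> M = 0.
Proof.
move=> M0; apply/matrixP => i j; rewrite mxE.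
have /matrixP/(_ i i) := M0; rewrite !mxE => /(congr1 (@complex.Re R)); rewrite re_sum /=.
have E k : Re (M i k * M^t* k i) = sqn (M i k) by rewrite !mxE sqnK.
move/eqP; rewrite psumr_eq0 => [/allP/(_ j)|k _]; last by rewrite E sqn_ge0.
by rewrite mem_index_enum E sqn_eq0 => /(_ isT)/eqP.
Qed.

(** The inequality half of trace-norm duality. In an eigenbasis of [A^* A] each diagonal entry pairs
    a unit row with the image under [K] of a vector whose length is a singular value of [A], and
    Cauchy-Schwarz applies. *)
Lemma re_tr_contraction n (A K : 'M[C]_n) :
  contraction K -> Re (\tr (K *m A)) <= trnorm A.
Proof.
move=> Kc; have := posmx_gram (A^t* ); rewrite trmxCK.
case/posmx_spectrum => P [d [Pu AE d0]].
rewrite /trnorm AE (mxfun_udiag _ _ Pu) (re_tr_udiag _ Pu).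
have -> : \tr (K *m A) = \tr (P *m (K *m (A *m P^t* ))).
  by rewrite [in RHS]mxtrace_mulC -!mulmxA unitary_adjK // mulmx1.
rewrite /mxtrace re_sum; apply: ler_sum => k _; rewrite mxE.
apply: re_mul_sum_le; first by rewrite mxE sqrtr_ge0.
  by rewrite (unitary_row_sqn k Pu).
rewrite mxE sqr_sqrtr // -(gram_udiag_col k Pu AE).
apply: le_trans (Kc _); rewrite [col k _]colE [K *m (_ *m delta_mx _ _)]mulmxA -colE.
by apply: ler_sum => i _; rewrite [col _ _ _ _]mxE.
Qed.

Lemma udiag_const1 n (P : 'M[C]_n) : P \is unitarymx ->
  udiag P (const_mx 1) = 1%:M.
Proof.
move=> Pu; rewrite /udiag /rdiag.
have -> : diag_mx (map_mx (real_complex R) (const_mx 1)) = 1%:M :> 'M[C]_n.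
  by apply/matrixP => i j; rewrite !mxE.
by rewrite mulmx1 unitary_adjK.
Qed.

(* W = rho^(-1/2) M with the pseudo-inverse: [(Num.sqrt 0)^-1 = 0]. *)
Lemma sqrt_gram_factor m n (M : 'M[C]_(n, m)) :
  exists2 W : 'M[C]_(n, m),
    M = mxfun Num.sqrt (M *m M^t* ) *m W & contraction (W^t* ).
Proof.
have [P [d [Pu ME d0]]] := posmx_spectrum (posmx_gram M).
pose t := map_mx (fun x => (Num.sqrt x)^-1) d.
pose e : 'rV[R]_n := \row_i (d 0 i != 0)%:R.
have sqd i : Num.sqrt (d 0 i) * Num.sqrt (d 0 i) = d 0 i.
  by rewrite -expr2 sqr_sqrtr.
have st i : Num.sqrt (d 0 i) * (Num.sqrt (d 0 i))^-1 = e 0 i.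
  rewrite mxE; have [->|dn0] := eqVneq (d 0 i) 0; first by rewrite sqrtr0 mul0r.
  by rewrite mulfV // sqrtr_eq0 -ltNge lt_neqAle eq_sym dn0 d0.
exists (udiag P t *m M).
  rewrite ME (mxfun_udiag _ _ Pu) mulmxA (udiagM _ _ Pu).
  have -> : \row_i ((map_mx Num.sqrt d) 0 i * t 0 i) = e.
    by apply/rowP => i; rewrite !mxE st mxE.
  (* [1 - e] gives the projection onto the kernel of [M *m M^t*]; the Gram matrix of the projected
     [M] is zero, so [M] has no component there. *)
  suff : udiag P (const_mx 1 - e) *m M = 0.
    by rewrite udiagB (udiag_const1 Pu) mulmxBl mul1mx => /subr0_eq.
  apply: gram_eq0; rewrite adjM udiag_adj -mulmxA [M *m _]mulmxA ME.
  rewrite !(udiagM _ _ Pu).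
  have -> : \row_i ((const_mx 1 - e) 0 i *
     (\row_j (d 0 j * (const_mx 1 - e) 0 j)) 0 i) = 0 :> 'rV[R]_n.
    apply/rowP => i; rewrite !mxE; have [->|_] := eqVneq (d 0 i) 0.
      by rewrite mul0r mulr0.
    by rewrite subrr mul0r.
  rewrite /udiag /rdiag.
  have -> : diag_mx (map_mx (real_complex R) 0) = 0 :> 'M[C]_n.
    by apply/matrixP => i j; rewrite !mxE mul0rn.
  by rewrite mulmx0 mul0mx.
move=> v; rewrite -quad_gram adjM udiag_adj -mulmxA [M *m _]mulmxA ME.
rewrite !(udiagM _ _ Pu) quad_udiag -[leRHS](nrm2_unitary _ Pu).
apply: ler_sum => i _; rewrite !mxE ler_piMl ?sqn_ge0 //.
rewrite mulrCA mulrA -mulrA -{1}sqd mulrACA st mulrC.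
by rewrite !mxE; case: eqP => _ /=; rewrite ?mulr0 ?mulr1 ?ler01.
Qed.

(** [M0] and [M1] are purifications, written as matrices, of the two states under the square roots,
    and [K] acts on the purifying side. Factoring each as a square root times a contraction brings
    all contractions next to [K] under the trace. *)
Lemma re_tr_overlap m n (M0 M1 : 'M[C]_(n, m)) (K : 'M[C]_m) :
  contraction K ->
  Re (\tr (K *m (M0^t* *m M1))) <=
  trnorm (mxfun Num.sqrt (M0 *m M0^t* ) *m mxfun Num.sqrt (M1 *m M1^t* )).
Proof.
move=> Kc; have [W0 E0 C0] := sqrt_gram_factor M0.
have [W1 E1 /contraction_adj] := sqrt_gram_factor M1; rewrite trmxCK => C1.
have Sh : (mxfun Num.sqrt (M0 *m M0^t* ))^t* = mxfun Num.sqrt (M0 *m M0^t* ).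
  have [P [d [Pu -> _]]] := posmx_spectrum (posmx_gram M0).
  by rewrite (mxfun_udiag _ _ Pu) udiag_adj.
set S0 := mxfun Num.sqrt (M0 *m M0^t* ) in E0 Sh *.
set S1 := mxfun Num.sqrt (M1 *m M1^t* ) in E1 *; clearbody S0 S1.
have -> : \tr (K *m (M0^t* *m M1)) = \tr (W1 *m K *m W0^t* *m (S0 *m S1)).
  rewrite E0 E1 adjM Sh -!mulmxA [in RHS]mxtrace_mulC.
  by rewrite !mulmxA.
by apply: re_tr_contraction; do 2?apply: contraction_mul.
Qed.

End Contractions.

(** * Continuity of the entropy *)

Section Entropy.
Variable R : realType.
Local Notation C := R[i].
Local Notation Re := complex.Re.

Lemma ln_sub_ge (a c : R) : 0 < a -> 0 < c -> 1 - a / c <= ln c - ln a.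
Proof.
move=> a0 c0; have q0 : 0 < a / c by rewrite divr_gt0.
have : ln (a / c) <= a / c - 1.
  rewrite -[X in ln X](subrK 1) addrC; apply: le_ln1Dx; lra.
by rewrite ln_div ?posrE //; lra.
Qed.

(** The right side is the form of [udiag Q c] at [Q^* y], which dominates that of [udiag P a]; of
    the latter only the [i]-th eigenvector is kept. *)
Lemma quad_le_rank1 n (P Q : 'M[C]_n) (a c : 'rV[R]_n) i (y : 'cV[C]_n) :
  Q \is unitarymx -> (forall k, 0 <= a 0 k) ->
  posmx (udiag Q c - udiag P a) ->
  a 0 i * sqn (\sum_j (P *m Q^t* ) i j * y j 0) <= \sum_j c 0 j * sqn (y j 0).
Proof.
move=> Qu a0 [_ /(_ (Q^t* *m y))]; rewrite quadB (quad_adj_unitary _ _ Qu).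
rewrite quad_udiag subr_ge0; apply: le_trans.
rewrite [leRHS](bigD1 i) //= [P *m (_ *m y)]mulmxA mxE lerDl sumr_ge0 // => k _.
by rewrite mulr_ge0 ?sqn_ge0.
Qed.

Section Overlap.
Variables (n : nat) (P Q : 'M[C]_n) (a c : 'rV[R]_n).
Hypotheses (Pu : P \is unitarymx) (Qu : Q \is unitarymx).
Hypotheses (a0 : forall k, 0 <= a 0 k) (c0 : forall k, 0 <= c 0 k).
Hypothesis ac : posmx (udiag Q c - udiag P a).
(** Squared overlaps of the two eigenbases: a doubly stochastic matrix, so that matrix inequalities
    become weighted scalar ones. *)
Let w i j := sqn ((P *m Q^t* ) i j).

Let w0 i j : 0 <= w i j. Proof. exact: sqn_ge0. Qed.

Let Tu : P *m Q^t* \is unitarymx.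
Proof. exact: unitary_mul_adj Pu Qu. Qed.

(* Needed because of the junk value [ln 0 = 0] where [c] vanishes. *)
Lemma overlap_kernel i j : c 0 j = 0 -> a 0 i * w i j = 0.
Proof.
move=> cj; have := quad_le_rank1 i (delta_mx j 0) Qu a0 ac.
rewrite (bigD1 j) //= [delta_mx _ _ _ _]mxE !eqxx mulr1 big1; last first.
  by move=> k /negbTE kj; rewrite [delta_mx _ _ _ _]mxE kj mulr0.
rewrite addr0 (bigD1 j) //= cj mul0r add0r big1; last first.
  by move=> k /negbTE kj; rewrite [delta_mx _ _ _ _]mxE kj sqn0 mulr0.
by move=> H; apply/eqP; rewrite eq_le H mulr_ge0 // w0.
Qed.

(** For the [i]-th eigenvector [p] of the smaller matrix and [C = udiag Q c], the sum is
    [x = <p, C^-1 p>] with the pseudo-inverse. Testing the order at [C^-1 p] gives [a x^2 <= x]. *)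
Lemma overlap_inv_le1 i : a 0 i * \sum_j w i j / c 0 j <= 1.
Proof.
set x := \sum_j _.
have := quad_le_rank1 i (\col_j ((c 0 j)^-1%:C%C * ((P *m Q^t* ) i j)^* )) Qu a0 ac.
have -> : \sum_j (P *m Q^t* ) i j *
    (\col_j ((c 0 j)^-1%:C%C * ((P *m Q^t* ) i j)^* )) j 0 = x%:C%C.
  rewrite /x real_complex_sum; apply: eq_bigr => j _.
  by rewrite [(\col__ _) _ _]mxE mulrCA sqnK -rmorphM /= mulrC.
have -> : \sum_j c 0 j *
    sqn ((\col_j ((c 0 j)^-1%:C%C * ((P *m Q^t* ) i j)^* )) j 0) = x.
  apply: eq_bigr => j _; rewrite [(\col__ _) _ _]mxE sqnM sqn_real sqnC.
  have [->|cn0] := eqVneq (c 0 j) 0; first by rewrite invr0 mulr0 mul0r.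
  by rewrite -/(w i j); field.
rewrite sqn_real => H.
have x0 : 0 <= x by rewrite sumr_ge0 // => j _; rewrite divr_ge0.
have [->|xn0] := eqVneq x 0; first by rewrite mulr0.
by rewrite -(ler_pM2r (x := x)) ?lt_neqAle ?x0 ?andbT 1?eq_sym // mul1r -mulrA -expr2.
Qed.

(** Averaging [ln c - ln a >= 1 - a / c] with the weights [w i j] leaves
    [1 - a_i * sum_j w i j / c_j], which [overlap_inv_le1] makes nonnegative. *)
Lemma overlap_ln_ge i : a 0 i * ln (a 0 i) <= \sum_j a 0 i * ln (c 0 j) * w i j.
Proof.
have [->|an0] := eqVneq (a 0 i) 0.
  by rewrite mul0r big1 // => j _; rewrite !mul0r.
have ai : 0 < a 0 i by rewrite lt_neqAle eq_sym an0 a0.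
have -> : a 0 i * ln (a 0 i) = \sum_j a 0 i * ln (a 0 i) * w i j.
  by rewrite -mulr_sumr (unitary_row_sqn i Tu) mulr1.
rewrite -subr_ge0 -sumrB.
have : 0 <= a 0 i * (1 - a 0 i * \sum_j w i j / c 0 j).
  by rewrite mulr_ge0 ?a0 // subr_ge0 overlap_inv_le1.
move/le_trans; apply.
rewrite -[X in X - _](unitary_row_sqn i Tu) mulr_sumr -sumrB mulr_sumr.
apply: ler_sum => j _; rewrite -/(w i j).
have [cj|cn0] := eqVneq (c 0 j) 0.
  have := overlap_kernel i cj => /eqP; rewrite mulf_eq0 (negbTE an0) /= => /eqP ->.
  by rewrite !(mul0r, mulr0, subr0).
have cj : 0 < c 0 j by rewrite lt_neqAle eq_sym cn0 c0.
have := ln_sub_ge ai cj; set u := _ / _ => H.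
have -> : a 0 i * (w i j - a 0 i * (w i j / c 0 j)) = a 0 i * w i j * (1 - u).
  by rewrite /u; ring.
have -> : a 0 i * ln (c 0 j) * w i j - a 0 i * ln (a 0 i) * w i j =
  a 0 i * w i j * (ln (c 0 j) - ln (a 0 i)) by ring.
by rewrite ler_wpM2l // mulr_ge0.
Qed.

(** Termwise this is [a - c <= a ln a - a ln c]; the row sums of [w] restore the spectrum [a], the
    column sums restore [c]. *)
Lemma overlap_klein :
  \sum_i a 0 i - \sum_j c 0 j <=
  \sum_i a 0 i * ln (a 0 i) - \sum_i \sum_j a 0 i * ln (c 0 j) * w i j.
Proof.
have -> : \sum_i a 0 i = \sum_i \sum_j a 0 i * w i j.
  by apply: eq_bigr => i _; rewrite -mulr_sumr (unitary_row_sqn i Tu) mulr1.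
have -> : \sum_j c 0 j = \sum_i \sum_j c 0 j * w i j.
  rewrite exchange_big; apply: eq_bigr => j _.
  by rewrite -mulr_sumr (unitary_col_sqn j Tu) mulr1.
have -> : \sum_i a 0 i * ln (a 0 i) = \sum_i \sum_j a 0 i * ln (a 0 i) * w i j.
  by apply: eq_bigr => i _; rewrite -mulr_sumr (unitary_row_sqn i Tu) mulr1.
rewrite -!sumrB; apply: ler_sum => i _; rewrite -!sumrB; apply: ler_sum => j _.
rewrite -!mulrBl.
have [cj|cn0] := eqVneq (c 0 j) 0.
  have := overlap_kernel i cj => /eqP; rewrite mulf_eq0.
  case/orP => /eqP E; last by rewrite E !mulr0.
  by rewrite E cj !mul0r subrr mul0r.
have cj : 0 < c 0 j by rewrite lt_neqAle eq_sym cn0 c0.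
rewrite ler_wpM2r //.
have [->|an0] := eqVneq (a 0 i) 0; first by rewrite !mul0r; lra.
have ai : 0 < a 0 i by rewrite lt_neqAle eq_sym an0 a0.
have E : a 0 i * (1 - c 0 j / a 0 i) = a 0 i - c 0 j by field.
by rewrite -E -mulrBr ler_pM2l // ln_sub_ge.
Qed.

End Overlap.

Lemma posmx_spectrum_pair n (A C : 'M[R[i]]_n) : posmx A -> posmx (C - A) ->
  exists (P Q : 'M[R[i]]_n) (a c : 'rV[R]_n), [/\ P \is unitarymx, Q \is unitarymx,
    forall i, 0 <= a 0 i & forall i, 0 <= c 0 i] /\
    [/\ A = udiag P a, C = udiag Q c & posmx (udiag Q c - udiag P a)].
Proof.
move=> Ap CAp; have Cp : posmx C by rewrite -(subrK A C); apply: posmxD.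
have [P [a [Pu AE a0]]] := posmx_spectrum Ap.
have [Q [c [Qu CE c0]]] := posmx_spectrum Cp.
exists P, Q, a, c; split; first exact: And4 Pu Qu a0 c0.
by split; [exact: AE | exact: CE | rewrite -AE -CE].
Qed.

Lemma re_tr_mul_mxfun n (P Q : 'M[C]_n) (a c : 'rV[R]_n) f : Q \is unitarymx ->
  Re (\tr (udiag P a *m mxfun f (udiag Q c))) =
  \sum_i \sum_j a 0 i * f (c 0 j) * sqn ((P *m Q^t* ) i j).
Proof.
move=> Qu; rewrite (mxfun_udiag f c Qu) re_tr_udiagM.
by apply: eq_bigr => i _; apply: eq_bigr => j _; rewrite mxE.
Qed.

(* Only this trace form of the operator monotonicity of [ln] is needed; it
   follows from [1 - 1/t <= ln t] in the two eigenbases. *)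
Lemma re_tr_ln_monotone n (A C : 'M[R[i]]_n) : posmx A -> posmx (C - A) ->
  Re (\tr (A *m mxfun (@ln R) A)) <= Re (\tr (A *m mxfun (@ln R) C)).
Proof.
move=> Ap /(posmx_spectrum_pair Ap) [P [Q [a [c [[Pu Qu a0 c0] [-> -> CAp]]]]]].
rewrite [leLHS](re_tr_mxfun a (@ln R) Pu) [leRHS](re_tr_mul_mxfun P a c (@ln R) Qu).
apply: ler_sum => i _; exact: overlap_ln_ge Pu Qu a0 c0 CAp i.
Qed.

(** The order hypothesis puts the support of [A] inside that of [C], so the convention [ln 0 = 0]
    does no harm in [ln C]. *)
Lemma klein_inequality n (A C : 'M[R[i]]_n) : posmx A -> posmx (C - A) ->
  Re (\tr A) - Re (\tr C) <=
  Re (\tr (A *m mxfun (@ln R) A)) - Re (\tr (A *m mxfun (@ln R) C)).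
Proof.
move=> Ap /(posmx_spectrum_pair Ap) [P [Q [a [c [[Pu Qu a0 c0] [-> -> CAp]]]]]].
rewrite [X in _ <= X - _](re_tr_mxfun a (@ln R) Pu).
rewrite [X in _ <= _ - X](re_tr_mul_mxfun P a c (@ln R) Qu).
rewrite [X in X - _ <= _](re_tr_udiag a Pu) [X in _ - X <= _](re_tr_udiag c Qu).
exact: overlap_klein Pu Qu a0 c0 CAp.
Qed.

Lemma posmx_trace_ge0 n (A : 'M[R[i]]_n) : posmx A -> 0 <= Re (\tr A).
Proof.
move=> /posmx_spectrum [P [a [Pu -> a0]]].
by rewrite (re_tr_udiag a Pu) sumr_ge0.
Qed.

(** Crude, from [ln c <= c <= tr C]; enough because it is applied to a positive part [A] of small
    trace. *)
Lemma re_tr_mul_ln_le n (A C : 'M[R[i]]_n) : posmx A -> posmx C ->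
  Re (\tr (A *m mxfun (@ln R) C)) <= Re (\tr A) * Re (\tr C).
Proof.
move=> /posmx_spectrum [P [a [Pu -> a0]]] /posmx_spectrum [Q [c [Qu -> c0]]].
rewrite [leLHS](re_tr_mul_mxfun P a c (@ln R) Qu).
rewrite [X in _ <= X * _](re_tr_udiag a Pu) [X in _ <= _ * X](re_tr_udiag c Qu).
rewrite mulr_suml; apply: ler_sum => i _.
rewrite -[leRHS]mulr1 -(unitary_row_sqn i (unitary_mul_adj Pu Qu)) mulr_sumr.
apply: ler_sum => j _; rewrite ler_wpM2r ?sqn_ge0 // ler_wpM2l //.
apply: (@le_trans _ _ (c 0 j)); last first.
  by rewrite (bigD1 j) //= lerDl sumr_ge0.
have [->|cn0] := eqVneq (c 0 j) 0; first by rewrite ln0.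
by rewrite ltW // ln_sublinear // lt_neqAle eq_sym cn0 c0.
Qed.

(** The graph of [x ln x] lies above its tangent at [expR (- L)]. The free [L] replaces the
    optimization over spectra that yields the dimension factor in Fannes-type bounds. *)
Lemma re_tr_mul_ln_ge n (A : 'M[R[i]]_n) (L : R) : posmx A ->
  - (Re (\tr A) * L + n%:R * expR (- L)) <= Re (\tr (A *m mxfun (@ln R) A)).
Proof.
move=> /posmx_spectrum [P [a [Pu -> a0]]].
rewrite [leRHS](re_tr_mxfun a (@ln R) Pu) [X in - (X * _ + _)](re_tr_udiag a Pu).
have -> : n%:R * expR (- L) = \sum_(i < n) expR (- L).
  by rewrite sumr_const card_ord mulr_natl.
rewrite mulr_suml -big_split /= -sumrN; apply: ler_sum => i _.
have [->|an0] := eqVneq (a 0 i) 0.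
  by rewrite !mul0r add0r oppr_le0 expR_ge0.
have ai : 0 < a 0 i by rewrite lt_neqAle eq_sym an0 a0.
have E : a 0 i * (1 - expR (- L) / a 0 i) = a 0 i - expR (- L) by field.
have := ln_sub_ge (expR_gt0 (- L)) ai; rewrite expRK opprK => H.
have : a 0 i - expR (- L) <= a 0 i * (ln (a 0 i) + L) by rewrite -E ler_pM2l.
by rewrite mulrDr; lra.
Qed.

Lemma max_pos_neg (x : R) : Num.max x 0 - Num.max (- x) 0 = x.
Proof. by case: (leP x 0) => h; case: (leP (- x) 0) => k; lra. Qed.

Lemma max_pos_neg_norm (x : R) : Num.max x 0 + Num.max (- x) 0 = `|x|.
Proof.
by case: (ger0P x) => h0; case: (leP x 0) => h; case: (leP (- x) 0) => k; lra.
Qed.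

(** [V] is the sign of [A]: a test that attains the trace norm, so that a bound on all tests
    controls both parts. *)
Lemma jordan_decomposition n (A : 'M[R[i]]_n) : A^t* = A ->
  exists Ap Am V : 'M[R[i]]_n,
    [/\ A = Ap - Am, posmx Ap, posmx Am, contraction V &
        Re (\tr (V *m A)) = Re (\tr Ap) + Re (\tr Am)].
Proof.
move=> Ah; have := hermitian_udiag Ah.
set P := spectralmx A; set d := map_mx _ _ => AE.
have Pu : P \is unitarymx := spectral_unitarymx A.
pose dp := map_mx (fun x => Num.max x 0) d.
pose dm := map_mx (fun x => Num.max (- x) 0) d.
pose s := map_mx (@Num.sg R) d.
exists (udiag P dp), (udiag P dm), (udiag P s); split.
- rewrite -udiagB [LHS]AE; congr udiag; apply/rowP => i.
  by rewrite !mxE max_pos_neg.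
- by apply: posmx_udiag => i; rewrite mxE le_max lexx orbT.
- by apply: posmx_udiag => i; rewrite mxE le_max lexx orbT.
- apply: (contraction_udiag Pu) => i; rewrite mxE sqr_sg.
  by case: eqP; rewrite ?lexx ?ler01.
rewrite [X in _ *m X]AE [X in \tr X](udiagM s d Pu) [LHS](re_tr_udiag _ Pu).
rewrite [X in _ = X + _](re_tr_udiag _ Pu) [X in _ = _ + X](re_tr_udiag _ Pu).
rewrite -big_split; apply: eq_bigr => i _.
by rewrite !mxE -normrEsg -max_pos_neg_norm.
Qed.

Lemma mul_add_mono (e f L : R) : 0 <= e -> e <= f -> 0 <= L ->
  e * (2 + e + L) <= f * (2 + f + L).
Proof. by move=> e0 ef L0; apply: ler_pM; lra. Qed.

(** [r], [s], [m] stand for [tr (Y ln Y)] at [Y = rho, sig, Dm]; [rX], [sX], [pX], [mX] for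
    [tr (Y ln X)] at [Y = rho, sig, Dp, Dm]; [e] is the common trace of [Dp] and [Dm]. *)
Lemma entropy_gap_arith (r s m rX sX pX mX e L b t : R) :
  r <= rX -> m <= mX -> 1 - (1 + e) <= s - sX -> pX <= e * (1 + e) ->
  - (e * L + t) <= m -> sX + pX = rX + mX -> e * (2 + e + L) <= b ->
  r - s <= b + t.
Proof. by move=> *; lra. Qed.

(** Write [rho - sig = Dp - Dm] and [X = sig + Dp = rho + Dm]. Under the trace, monotonicity bounds
    [rho ln rho] above by [rho ln X], Klein's inequality bounds [sig ln sig] below by [sig ln X] up
    to [tr Dm], and the remaining gap is [(Dp - Dm) ln X]. *)
Lemma ln_entropy_continuity n (rho sig : 'M[R[i]]_n) (eps L : R) :
  posmx rho -> posmx sig -> Re (\tr rho) = 1 -> Re (\tr sig) = 1 -> 0 <= L ->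
  (forall V, contraction V -> Re (\tr (V *m (rho - sig))) <= 2 * eps) ->
  Re (\tr (rho *m mxfun (@ln R) rho)) - Re (\tr (sig *m mxfun (@ln R) sig))
    <= eps * (2 + eps + L) + n%:R * expR (- L).
Proof.
move=> rp sp r1 s1 L0 H.
have Dh : (rho - sig)^t* = rho - sig by rewrite adjB rp.1 sp.1.
have [Dp [Dm [V [DE Dp0 Dm0 Vc VE]]]] := jordan_decomposition Dh.
have trB (X Y : 'M[R[i]]_n) : Re (\tr (X - Y)) = Re (\tr X) - Re (\tr Y).
  by rewrite raddfB reD reN.
have trD (X Y : 'M[R[i]]_n) : Re (\tr (X + Y)) = Re (\tr X) + Re (\tr Y).
  by rewrite raddfD reD.
have trE : Re (\tr Dp) = Re (\tr Dm).
  by apply/eqP; rewrite -subr_eq0 -trB -DE trB r1 s1 subrr.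
have e0 := posmx_trace_ge0 Dm0.
have ee : Re (\tr Dm) <= eps by have := H V Vc; rewrite VE trE; lra.
(* X dominates both states and exceeds each of them by trace at most eps. *)
pose X := sig + Dp; have XE : X = rho + Dm.
  by rewrite /X -(subrK sig rho) DE addrAC subrK addrC.
have Xp : posmx X by apply: posmxD.
have := re_tr_ln_monotone rp (C := X); rewrite XE addrC addKr -XE => /(_ Dm0) Ha.
have := re_tr_ln_monotone Dm0 (C := X); rewrite XE addrK -XE => /(_ rp) Hb.
have := klein_inequality sp (C := X); rewrite {1}/X addrC addKr => /(_ Dp0) Hc.
have Hd := re_tr_mul_ln_le Dp0 Xp.
have He := re_tr_mul_ln_ge L Dm0.
have XX : Re (\tr (sig *m mxfun (@ln R) X)) + Re (\tr (Dp *m mxfun (@ln R) X)) =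
          Re (\tr (rho *m mxfun (@ln R) X)) + Re (\tr (Dm *m mxfun (@ln R) X)).
  by rewrite -!trD -!mulmxDl -XE.
have X1 : Re (\tr X) = 1 + Re (\tr Dm) by rewrite XE trD r1.
rewrite s1 X1 in Hc; rewrite X1 trE in Hd.
exact: entropy_gap_arith Ha Hb Hc Hd He XX (mul_add_mono e0 ee L0).
Qed.

End Entropy.

(** * The polar transform *)

Section PolarMatrix.
Local Open Scope nat_scope.

Definition nth_bit (r k : nat) : bool := odd (r %/ 2 ^ k).

Lemma nth_bit_sum n (b : nat -> bool) j : j < n ->
  nth_bit (\sum_(k < n) b k * 2 ^ k) j = b j.
Proof.
have step m (c : nat -> bool) :
    \sum_(k < m.+1) c k * 2 ^ k = c 0 + (\sum_(k < m) c k.+1 * 2 ^ k) * 2.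
  rewrite big_ord_recl /= expn0 muln1 big_distrl /=; congr (_ + _).
  by apply: eq_bigr => k _; rewrite expnSr mulnA.
elim: n b j => // n IH b [|j] jn; rewrite /nth_bit step.
  by rewrite expn0 divn1 oddD oddM andbF addbF oddb.
have b2 : b 0 < 2 by case: (b 0).
rewrite expnS divnMA addnC divnMDl // (divn_small b2) addn0.
exact: (IH (fun k => b k.+1)).
Qed.

Lemma sum_bits_lt n (b : nat -> bool) : \sum_(k < n) b k * 2 ^ k < 2 ^ n.
Proof.
elim: n => [|n IH]; first by rewrite big_ord0.
rewrite big_ord_recr /= expnS mul2n -addnn -addSn leq_add //.
by case: (b n); rewrite ?mul1n ?mul0n.
Qed.

Lemma sum_nth_bit n r : r < 2 ^ n -> \sum_(k < n) nth_bit r k * 2 ^ k = r.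
Proof.
elim: n r => [|n IH] r rn.
  by rewrite big_ord0; case: r rn.
rewrite big_ord_recl /= expn0 muln1 /nth_bit expn0 divn1.
have -> : \sum_(i < n) odd (r %/ 2 ^ bump 0 i) * 2 ^ bump 0 i =
          (\sum_(i < n) nth_bit (r %/ 2) i * 2 ^ i) * 2.
  rewrite big_distrl /=; apply: eq_bigr => i _.
  by rewrite /nth_bit /bump add1n expnSr -mulnA -divnMA -expnS expnSr.
rewrite IH; first by rewrite divn2 muln2 odd_double_half.
by rewrite ltn_divLR // -expnSr.
Qed.

Lemma bit_reverse_sum n r :
  bit_reverse n r = \sum_(k < n) nth_bit r (n.-1 - k) * 2 ^ k.
Proof.
rewrite /bit_reverse (reindex_inj rev_ord_inj) /=; apply: eq_bigr => k _.
by rewrite /nth_bit; case: n k => [[]//|n] k /=; rewrite subSS subKn // -ltnS.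
Qed.

Lemma bit_reverse_lt n r : bit_reverse n r < 2 ^ n.
Proof.
rewrite bit_reverse_sum.
exact: (sum_bits_lt n (fun k => nth_bit r (n.-1 - k))).
Qed.

Lemma nth_bit_reverse n r j : j < n ->
  nth_bit (bit_reverse n r) j = nth_bit r (n.-1 - j).
Proof.
by move=> jn; rewrite bit_reverse_sum (nth_bit_sum (fun k => nth_bit r (n.-1 - k))).
Qed.

Lemma bit_reverseK n r : r < 2 ^ n -> bit_reverse n (bit_reverse n r) = r.
Proof.
move=> rn; rewrite bit_reverse_sum -[RHS](sum_nth_bit rn).
apply: eq_bigr => k _; rewrite nth_bit_reverse; last first.
  by case: n k rn => [[]//|n] k rn /=; rewrite ltnS leq_subr.
by case: n k rn => [[]//|n] k rn /=; rewrite subKn // -ltnS.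
Qed.

Local Open Scope ring_scope.

(** Each tensor factor contributes one binary digit, and [polar_kernel] vanishes only at row digit
    0, column digit 1. In product form a permutation of the digits, such as bit reversal, merely
    permutes the factors. *)
Lemma kron_powE n (r c : 'I_(2 ^ n)) :
  kron_pow n r c = \prod_(k < n) (nth_bit c k ==> nth_bit r k)%:R.
Proof.
elim: n r c => [|n IH] r c.
  by rewrite big_ord0 mxE; case: r c => [[|//] ?] [[|//] ?].
rewrite big_ord_recr /= castmxE /= !esymK.
set r' := cast_ord _ r; set c' := cast_ord _ c.
have -> : nat_of_ord r = r' by []. have -> : nat_of_ord c = c' by [].
move: r' c' => r' c' {r c}.
case: (mxtens.mxtens_indexP r') => i j; case: (mxtens.mxtens_indexP c') => k l.
rewrite mxtens.tensmxE IH mulrC /=.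
(* The left tensor factor carries the most significant digit. *)
have hi (a : 'I_2) (b : 'I_(2 ^ n)) : nth_bit (a * 2 ^ n + b) n = odd a.
  by rewrite /nth_bit divnMDl ?expn_gt0 // divn_small ?addn0.
have lo (a b m : nat) : (m < n)%N -> nth_bit (a * 2 ^ n + b) m = nth_bit b m.
  move=> mn; rewrite /nth_bit -(subnK (ltnW mn)) expnD mulnA divnMDl ?expn_gt0 //.
  by rewrite oddD oddM oddX subn_eq0 leqNgt mn andbF.
rewrite !hi; congr (_ * _); last first.
  by rewrite mxE; case: i k => [[|[|//]] ?] [[|[|//]] ?].
by apply: eq_bigr => m _; rewrite !lo ?ltn_ord.
Qed.

Lemma castmx_mulmx m n (e : m = n) (A B : 'M[bit]_m) :
  castmx (e, e) A *m castmx (e, e) B = castmx (e, e) (A *m B).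
Proof. by case: n / e. Qed.

Lemma kron_pow_involutive n : kron_pow n *m kron_pow n = 1%:M.
Proof.
elim: n => [|n IH] /=; first by rewrite mulmx1.
rewrite castmx_mulmx mxtens.tensmx_mul IH.
have -> : polar_kernel *m polar_kernel = 1%:M.
  apply/matrixP => i j; rewrite !mxE !big_ord_recl big_ord0 !mxE.
  by case: i j => [[|[|//]] ?] [[|[|//]] ?]; apply/eqP.
have -> : mxtens.tensmx 1%:M 1%:M = 1%:M :> 'M[bit]_(2 * 2 ^ n).
  apply/matrixP => r c; case: (mxtens.mxtens_indexP r) => i j.
  case: (mxtens.mxtens_indexP c) => k l; rewrite mxtens.tensmxE !mxE.
  by rewrite (can_eq (@mxtens.mxtens_indexK _ _)) xpair_eqE -natrM mulnb.
by apply/matrixP => i j; rewrite castmxE !mxE (inj_eq (@cast_ord_inj _ _ _)).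
Qed.

Lemma reverse_mulmx n m (A : 'M[bit]_(2 ^ n, m)) r c :
  (reverse_mx n *m A) r c = A (Ordinal (bit_reverse_lt n r)) c.
Proof.
rewrite mxE (bigD1 (Ordinal (bit_reverse_lt n r))) //= mxE eqxx mul1r.
rewrite big1 ?addr0 // => j /negbTE jr.
by rewrite mxE; move: jr; rewrite -val_eqE /= => ->; rewrite mul0r.
Qed.

Lemma mulmx_reverse n m (A : 'M[bit]_(m, 2 ^ n)) r c :
  (A *m reverse_mx n) r c = A r (Ordinal (bit_reverse_lt n c)).
Proof.
rewrite mxE (bigD1 (Ordinal (bit_reverse_lt n c))) //= mxE /=.
rewrite bit_reverseK // eqxx mulr1 big1 ?addr0 // => j jc; rewrite mxE.
case: eqP => [cj|]; last by rewrite mulr0.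
by case/eqP: jc; apply: val_inj; rewrite /= cj bit_reverseK.
Qed.

(** Bit reversal permutes [n] equal tensor factors, hence commutes with [kron_pow n]; both matrices
    are involutions, the second because [polar_kernel] squares to 1 over [F_2]. *)
Lemma polar_mx_involutive n : polar_mx n *m polar_mx n = 1%:M.
Proof.
rewrite /polar_mx.
have RK : reverse_mx n *m kron_pow n = kron_pow n *m reverse_mx n.
  apply/matrixP => r c; rewrite reverse_mulmx mulmx_reverse !kron_powE.
  rewrite (reindex_inj rev_ord_inj) /=; apply: eq_bigr => k _.
  have kn : (n - k.+1 = n.-1 - k)%N by case: n {r c} k => [[]//|n] k; rewrite subSS.
  rewrite !nth_bit_reverse ?kn //; last by rewrite -kn rev_ord_proof.
  by congr (_ ==> nth_bit _ _)%:R; case: n {r c kn} k => [[]//|n] k /=; rewrite subKn // -ltnS.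
have RR : reverse_mx n *m reverse_mx n = 1%:M.
  apply/matrixP => r c; rewrite reverse_mulmx !mxE /= bit_reverseK //.
  by rewrite eq_sym.
by rewrite {1}RK -mulmxA [reverse_mx n *m (_ *m _)]mulmxA RR mul1mx kron_pow_involutive.
Qed.

End PolarMatrix.

(** * Matrix entries, signs and bit strings *)

Section Entries.
Variable R : realType.
Local Notation C := R[i].
Local Notation Re := complex.Re.

Lemma entryE (I J : finType) (f : I -> J -> C) x y : entry (of_entries f) x y = f x y.
Proof. by rewrite /entry mxE !enum_rankK. Qed.

Lemma entryP (I J : finType) (A B : Lin R J I) :
  (forall x y, entry A x y = entry B x y) -> A = B.
Proof.
move=> H; apply/matrixP => k l.
by have := H (enum_val k) (enum_val l); rewrite /entry !enum_valK.
Qed.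

Lemma big_enum_rank (V : nmodType) (I : finType) (F : 'I_#|{: I}| -> V) :
  \sum_k F k = \sum_x F (enum_rank x).
Proof.
rewrite (reindex (@enum_rank I)) //; exists enum_val => x _.
  exact: enum_rankK.
exact: enum_valK.
Qed.

Lemma sum_pair (V : nmodType) (I J : finType) (F : I * J -> V) :
  \sum_x F x = \sum_i \sum_j F (i, j).
Proof. by rewrite pair_bigA; apply: eq_bigr => -[]. Qed.

Lemma entry_mul (I J K : finType) (A : Lin R J I) (B : Lin R K J) x y :
  entry (A *m B) x y = \sum_z entry A x z * entry B z y.
Proof. by rewrite /entry mxE big_enum_rank. Qed.

Lemma entry_adj (I J : finType) (A : Lin R J I) x y :
  entry (A^t* : Lin R I J) x y = (entry A y x)^*.
Proof. by rewrite /entry !mxE. Qed.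

Lemma entry_tr (I J : finType) (A : Lin R J I) x y :
  entry (A^T : Lin R I J) x y = entry A y x.
Proof. by rewrite /entry !mxE. Qed.

Lemma tr_entry (I : finType) (A : Op R I) : \tr A = \sum_x entry A x x.
Proof. by rewrite /mxtrace big_enum_rank. Qed.

Lemma tr_mul_entry (I J : finType) (A : Lin R J I) (B : Lin R I J) :
  \tr (A *m B) = \sum_x \sum_y entry A x y * entry B y x.
Proof. by rewrite tr_entry; apply: eq_bigr => x _; rewrite entry_mul. Qed.

Lemma entry_scale (I J : finType) (c : C) (A : Lin R J I) x y :
  entry (c *: A) x y = c * entry A x y.
Proof. by rewrite /entry mxE. Qed.

Lemma entry_sum (I J T : finType) (F : T -> Lin R J I) x y :
  entry (\sum_t F t) x y = \sum_t entry (F t) x y.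
Proof. by rewrite /entry summxE. Qed.

Lemma entry_ket (I : finType) (a : I) x : (ket R a) (enum_rank x) 0 = (x == a)%:R.
Proof. by rewrite mxE eqxx andbT (inj_eq enum_rank_inj). Qed.

Lemma entry_ketbra (I : finType) (v : Ket R I) x y :
  entry (ketbra v) x y = v (enum_rank x) 0 * (v (enum_rank y) 0)^*.
Proof. by rewrite /entry mxE big_ord_recl big_ord0 addr0 !mxE. Qed.

Lemma entry_ketbra_ket (I : finType) (a x y : I) :
  entry (ketbra (ket R a)) x y = ((x == a) && (y == a))%:R.
Proof.
by rewrite entry_ketbra !entry_ket conjC_nat -natrM mulnb.
Qed.

Lemma entry_tens (I J K L : finType) (A : Lin R J I) (B : Lin R L K) x y :
  entry (tens A B) x y = entry A x.1 y.1 * entry B x.2 y.2.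
Proof. by rewrite entryE. Qed.

Lemma entry_1 (I : finType) (x y : I) : entry (1%:M : Op R I) x y = (x == y)%:R.
Proof. by rewrite /entry mxE (inj_eq enum_rank_inj). Qed.

Lemma entry_outputs (I : finType) N (W : bit -> Op R I) (y : 'rV[bit]_N) p q :
  entry (outputs W y) p q = \prod_k entry (W (y 0 k)) (p k) (q k).
Proof. by rewrite entryE. Qed.

Definition blockdiag (T I : finType) (D : T -> Op R I) : Op R (T * I) :=
  of_entries (fun x y => (x.1 == y.1)%:R * entry (D x.1) x.2 y.2).

Lemma contraction_blockdiag (T I : finType) (D : T -> Op R I) :
  (forall t, contraction (D t)) -> contraction (blockdiag D).
Proof.
move=> Dc v; rewrite /nrm2 !big_enum_rank !sum_pair.
apply: ler_sum => t _.
pose w : Ket R I := \col_k v (enum_rank (t, enum_val k)) 0.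
have := Dc t w; rewrite /nrm2 !big_enum_rank.
have -> : \sum_x sqn (w (enum_rank x) 0) = \sum_x sqn (v (enum_rank (t, x)) 0).
  by apply: eq_bigr => x _; rewrite mxE enum_rankK.
congr (_ <= _); apply: eq_bigr => x _; congr sqn.
rewrite !mxE !big_enum_rank sum_pair (bigD1 t) //= [X in _ + X]big1 ?addr0.
  apply: eq_bigr => y _; rewrite mxE enum_rankK; congr (_ * _).
  by rewrite -/(entry (blockdiag D) _ _) entryE eqxx mul1r.
move=> s st; rewrite big1 // => y _.
rewrite -/(entry (blockdiag D) _ _) entryE /= eq_sym.
by move/negbTE: st => ->; rewrite !mul0r.
Qed.

End Entries.

Section Signs.
Variable R : realType.
Local Notation C := R[i].

Definition sgn (z : bit) : C := (-1) ^+ (z : nat).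

Lemma sgnD (y z : bit) : sgn (y + z) = sgn y * sgn z.
Proof.
by rewrite /sgn -exprD -[RHS]signr_odd -modn2.
Qed.

Lemma sgn0 : sgn 0 = 1.
Proof. by rewrite /sgn expr0. Qed.

Lemma sgn1 : sgn 1 = -1.
Proof. by rewrite /sgn expr1. Qed.

Lemma sgnC (z : bit) : (sgn z)^* = sgn z.
Proof. by rewrite /sgn rmorphXn rmorphN1. Qed.

Lemma sgn_sum (I : Type) (r : seq I) (F : I -> bit) :
  sgn (\sum_(k <- r) F k) = \prod_(k <- r) sgn (F k).
Proof. by elim/big_rec2: _ => [|k y1 y2 _ <-]; rewrite ?sgn0 ?sgnD. Qed.

Definition dot N (y z : 'rV[bit]_N) : bit := \sum_k y 0 k * z 0 k.

Lemma dotE N (y z : 'rV[bit]_N) : dot y z = (y *m z^T) 0 0.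
Proof. by rewrite mxE; apply: eq_bigr => k _; rewrite mxE. Qed.

Lemma dotDr N (y z w : 'rV[bit]_N) : dot y (z + w) = dot y z + dot y w.
Proof. by rewrite !dotE linearD mulmxDr mxE. Qed.

Lemma dotDl N (y z w : 'rV[bit]_N) : dot (y + z) w = dot y w + dot z w.
Proof. by rewrite !dotE mulmxDl mxE. Qed.

Lemma dot_mulmx_tr N (y z : 'rV[bit]_N) (G : 'M[bit]_N) :
  dot (y *m G^T) z = dot y (z *m G).
Proof. by rewrite !dotE trmx_mul mulmxA. Qed.

(** Masking instead of truncating keeps all prefixes in one space, so that they add and can be
    spliced with tails. *)
Definition prefix N (i : nat) (u : 'rV[bit]_N) : 'rV[bit]_N :=
  \row_k (if (k < i)%N then u 0 k else 0).

Lemma prefixD N i (u v : 'rV[bit]_N) : prefix i (u + v) = prefix i u + prefix i v.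
Proof. by apply/rowP => k; rewrite !mxE; case: ifP => _; rewrite ?mxE ?addr0. Qed.

Lemma bit_addKK (x : bit) : x + x = 0.
Proof. by case: x => [[|[|//]] ?]; apply/val_inj. Qed.

Lemma rV_bit_addKK N (u : 'rV[bit]_N) : u + u = 0.
Proof. by apply/rowP => k; rewrite !mxE bit_addKK. Qed.

Lemma rV_bit_add_eq0 N (u v : 'rV[bit]_N) : (u + v == 0) = (u == v).
Proof.
apply/eqP/eqP => [H|->]; rewrite ?rV_bit_addKK //.
by rewrite -[u]addr0 -(rV_bit_addKK v) addrA H add0r.
Qed.

Section BitStrings.
Variables (N : nat) (i : 'I_N).
Implicit Types (a : i.-tuple bit) (b : (N - i.+1).-tuple bit).

Definition zeros : i.-tuple bit := [tuple 0 | k < i].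

Lemma bit_string_prefix a x b (k : 'I_N) (ki : (k < i)%N) :
  bit_string a x b 0 k = tnth a (Ordinal ki).
Proof. by rewrite mxE nth_cat size_tuple ki (tnth_nth 0). Qed.

Lemma bit_string_suffix a a' x b (k : 'I_N) : (i <= k)%N ->
  bit_string a x b 0 k = bit_string a' x b 0 k.
Proof. by move=> ik; rewrite !mxE !nth_cat !size_tuple ltnNge ik. Qed.

Lemma bit_string_at a x b : bit_string a x b 0 i = x.
Proof. by rewrite mxE nth_cat size_tuple ltnn subnn. Qed.

Lemma bit_string_at_neq a x x' b (k : 'I_N) : k != i ->
  bit_string a x b 0 k = bit_string a x' b 0 k.
Proof.
move=> ki; rewrite !mxE !nth_cat !size_tuple; case: ltnP => // ik.
have : (0 < k - i)%N by rewrite subn_gt0 ltn_neqAle eq_sym ki.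
by case: (k - i)%N.
Qed.

(** Orthogonality of characters: the average over the first [i] bits cancels unless [w] vanishes on
    them. *)
Lemma sum_sgn_dot_prefix x b (w : 'rV[bit]_N) :
  \sum_a 2 ^- i * sgn (dot (bit_string a x b) w) =
  (prefix i w == 0)%:R * sgn (dot (bit_string zeros x b) w).
Proof.
rewrite -mulr_sumr; case: eqP => [w0|/eqP w0].
  have E a : sgn (dot (bit_string a x b) w) = sgn (dot (bit_string zeros x b) w).
    congr sgn; apply: eq_bigr => k _; case: (ltnP k i) => ki.
      have /rowP/(_ k) := w0; rewrite !mxE ki => ->; by rewrite !mulr0.
    by rewrite (bit_string_suffix a zeros).
  have card_bits : #|{: i.-tuple bit}| = (2 ^ i)%N by rewrite card_tuple card_ord.
  rewrite (eq_bigr _ (fun a _ => E a)) sumr_const card_bits mul1r.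
  by rewrite -[X in _ * X]mulr_natl natrX mulrA mulVf ?mul1r // expf_neq0 // pnatr_eq0.
have [k wk] : exists k, prefix i w 0 k != 0.
  by apply/existsP; apply: contraNT w0; rewrite negb_exists => /forallP H;
     apply/eqP/rowP => k; move: (H k); rewrite negbK => /eqP ->; rewrite mxE.
move: wk; rewrite mxE; case: ltnP => [ki wk|_]; last by rewrite eqxx.
have {}wk : w 0 k = 1 by move: wk; case: (w 0 k) => [[|[|//]] ?] // _; apply/val_inj.
pose k' : 'I_i := Ordinal ki.
(* Flipping bit [k], where [w] has a 1, reverses every sign, so the sum equals its own opposite. *)
pose flip a : i.-tuple bit := [tuple tnth a j + (j == k')%:R | j < i].
have flipK : involutive flip.
  move=> a; apply: eq_from_tnth => j; rewrite !tnth_mktuple -addrA bit_addKK.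
  by rewrite addr0.
have flipE a : bit_string (flip a) x b = bit_string a x b + delta_mx 0 k.
  apply/rowP => j; rewrite [RHS]mxE [delta_mx _ _ _ _]mxE eqxx /=; case: (ltnP j i) => ji.
    by rewrite !(bit_string_prefix _ _ _ ji) tnth_mktuple.
  have /negbTE -> : j != k by apply: contraTneq ji => ->; rewrite -ltnNge.
  by rewrite addr0 (bit_string_suffix _ a).
have dw : dot (delta_mx 0 k) w = 1.
  rewrite /dot (bigD1 k) //= mxE !eqxx mul1r wk big1 ?addr0 // => j /negbTE jk.
  by rewrite mxE jk andbF mul0r.
rewrite mul0r; set S := \sum_a _.
have SE : S = - S.
  rewrite {1}/S (reindex_inj (inv_inj flipK)) /= -sumrN; apply: eq_bigr => a _.
  by rewrite flipE dotDl sgnD dw sgn1 mulrN1.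
have : S *+ 2 = 0 by rewrite mulr2n {1}SE addNr.
by move/eqP; rewrite mulrn_eq0 /= => /eqP ->; rewrite mulr0.
Qed.

End BitStrings.
End Signs.

(** * Phase channel to Bob versus amplitude channel to Eve *)

Section Uncertainty.
Variable R : realType.
Local Notation C := R[i].
Local Notation Re := complex.Re.
Local Notation sgn := (@sgn R).
Variables (I E : finType) (col : I -> bit) (th : I -> E -> C).
Variables (W : bit -> Op R I) (sigma : bit -> Op R E).
(** One pure state with amplitudes [th p e] underlies both channels, and [col p] is the value of the
    bit [C] inside [p]. [W x] is its reduction to [I] after [Z^x] on [C]; [sigma z] is Eve's state
    conditioned on [C = z], an event of probability 1/2, whence the factor 2 below. *)
Hypothesis WE : forall x p q,
  entry (W x) p q = sgn (x * (col p + col q)) * \sum_e th p e * (th q e)^*.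
Hypothesis sigmaE : forall z e e',
  entry (sigma z) e e' = 2 * \sum_(p | col p == z) th p e * (th p e')^*.

Definition word N (p : {ffun 'I_N -> I}) : 'rV[bit]_N := \row_k col (p k).

Definition amp N (p : {ffun 'I_N -> I}) (e : {ffun 'I_N -> E}) : C :=
  \prod_k th (p k) (e k).

Lemma outputs_phaseE N (y : 'rV[bit]_N) p q :
  entry (outputs W y) p q =
  sgn (dot y (word p + word q)) * \sum_e amp p e * (amp q e)^*.
Proof.
rewrite entry_outputs (eq_bigr _ (fun k _ => WE _ _ _)) big_split /= -sgn_sum.
congr (sgn _ * _); first by apply: eq_bigr => k _; rewrite !mxE.
rewrite bigA_distr_bigA /=; apply: eq_bigr => e _.
by rewrite big_split /= /amp rmorph_prod.
Qed.

Lemma outputs_eveE N (z : 'rV[bit]_N) e e' :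
  entry (outputs sigma z) e e' =
  2 ^+ N * \sum_(p | word p == z) amp p e * (amp p e')^*.
Proof.
rewrite entry_outputs (eq_bigr _ (fun k _ => sigmaE _ _ _)) big_split /=.
rewrite prodr_const card_ord; congr (_ * _).
rewrite bigA_distr_big_dep /=; apply: eq_big => [p|p _].
  apply/familyP/eqP => [H|<- k]; last by rewrite unfold_in /= mxE.
  by apply/rowP => k; have := H k; rewrite unfold_in /= mxE => /eqP.
by rewrite big_split /= /amp rmorph_prod.
Qed.

Section Synthesized.
Variables (n : nat) (i : 'I_(2 ^ n)).
Local Notation N := (2 ^ n)%N.
Local Notation suffix := ((N - i.+1).-tuple bit).

(** As [polar_mx n] is an involution, this is the input whose encoding is the word of [p]. *)
Definition uword (p : {ffun 'I_N -> I}) : 'rV[bit]_N := word p *m polar_mx n.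

Definition phase_sign (x : bit) (b : suffix) (u : 'rV[bit]_N) : C :=
  sgn (dot (bit_string (zeros i) x b) u).

Definition suffix_weight : R := Num.sqrt (2 ^- (N - i.+1)).

(* A column (v, b, e) carries a copy v of the prefix of u: averaging over the
   phases of these bits is the same as tracing out such a copy. *)
Definition phase_root (x : bit) :
  Lin R (('rV[bit]_N * suffix) * {ffun 'I_N -> E}) (suffix * {ffun 'I_N -> I}) :=
  of_entries (fun r c =>
    ((r.1 == c.1.2) && (prefix i (uword r.2) == c.1.1))%:R *
    (suffix_weight%:C%C * phase_sign x r.1 (uword r.2) * amp r.2 c.2)).

Lemma suffix_weight_conj : (suffix_weight%:C%C : C)^* = suffix_weight%:C%C.
Proof. by apply/CrealP; rewrite complex_real. Qed.

Lemma suffix_weight_sqr : suffix_weight%:C%C * suffix_weight%:C%C = 2 ^- (N - i.+1) :> C.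
Proof.
rewrite -rmorphM -expr2 sqr_sqrtr ?invr_ge0 ?exprn_ge0 //.
by rewrite /= fmorphV rmorphXn /= rmorph_nat.
Qed.

(** Moving the transposed encoder onto the words turns the average over the first [i] phase bits
    into a character sum, which erases the coherence between different prefixes. *)
Lemma synth_phaseE x r r' :
  entry (synth_phase W i x) r r' =
  (r.1 == r'.1)%:R * 2 ^- (N - i.+1) *
  ((prefix i (uword r.2) == prefix i (uword r'.2))%:R *
   (phase_sign x r.1 (uword r.2) * phase_sign x r.1 (uword r'.2)) *
   \sum_e amp r.2 e * (amp r'.2 e)^* ).
Proof.
case: r r' => [b p] [b' q] /=.
rewrite /synth_phase entry_sum (bigD1 b) //= [X in _ + X]big1 ?addr0; last first.
  move=> c /negbTE cb; rewrite entry_scale entry_tens entry_ketbra_ket /=.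
  by rewrite eq_sym cb mul0r mulr0.
rewrite entry_scale entry_tens entry_ketbra_ket eqxx /= mulrCA -mulrA [b' == b]eq_sym.
congr (_ * (_ * _)); rewrite entry_sum.
transitivity (\sum_(a : i.-tuple bit)
   2 ^- i * sgn (dot (bit_string a x b) (uword p + uword q)) *
   \sum_e amp p e * (amp q e)^* ).
  apply: eq_bigr => a _; rewrite entry_scale outputs_phaseE mulrA.
  by rewrite dot_mulmx_tr mulmxDl.
rewrite -mulr_suml sum_sgn_dot_prefix prefixD rV_bit_add_eq0.
by rewrite dotDr sgnD.
Qed.

Lemma phase_root_gram x : phase_root x *m (phase_root x)^t* = synth_phase W i x.
Proof.
apply: entryP => r r'; rewrite entry_mul synth_phaseE !sum_pair.
rewrite (bigD1 (prefix i (uword r.2))) //= [X in _ + X]big1 ?addr0; last first.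
  move=> v /negbTE vr; rewrite big1 // => b _; rewrite big1 // => e _.
  by rewrite entryE /= [_ == v]eq_sym vr andbF !mul0r.
rewrite (bigD1 r.1) //= [X in _ + X]big1 ?addr0; last first.
  move=> b /negbTE br; rewrite big1 // => e _.
  by rewrite entryE /= [_ == b]eq_sym br !mul0r.
transitivity (\sum_e (r.1 == r'.1)%:R * 2 ^- (N - i.+1) *
  ((prefix i (uword r.2) == prefix i (uword r'.2))%:R *
   (phase_sign x r.1 (uword r.2) * phase_sign x r.1 (uword r'.2)) *
   (amp r.2 e * (amp r'.2 e)^* ))); last by rewrite -!mulr_sumr.
apply: eq_bigr => e _; rewrite entry_adj !entryE /= !eqxx mul1r.
rewrite !rmorphM /= conjC_nat suffix_weight_conj /phase_sign sgnC -suffix_weight_sqr.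
rewrite [r'.1 == r.1]eq_sym [_ == prefix i (uword r.2)]eq_sym.
have [->|_] := eqVneq r.1 r'.1; last by rewrite /= !mul0r mulr0.
by rewrite /=; ring.
Qed.

(** In the overlap of two roots Eve's indices appear transposed relative to her state, hence
    [(D t.1)^T]. The test is controlled by the copied prefix and does not look at the suffix. *)
Definition eve_test (D : 'rV[bit]_N -> Op R {ffun 'I_N -> E}) :
    Op R (('rV[bit]_N * suffix) * {ffun 'I_N -> E}) :=
  blockdiag (fun t => (D t.1)^T).

Lemma contraction_eve_test D : (forall v, contraction (D v)) ->
  contraction (eve_test D).
Proof. by move=> Dc; apply: contraction_blockdiag => t; apply: contraction_tr. Qed.

Lemma phase_signC x b u : (phase_sign x b u)^* = phase_sign x b u.
Proof. exact: sgnC. Qed.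

Lemma phase_sign01 b u : phase_sign 0 b u * phase_sign 1 b u = sgn (u 0 i).
Proof.
rewrite /phase_sign -sgnD -dotDl; congr sgn.
rewrite /dot (bigD1 i) //= mxE !bit_string_at add0r mul1r big1 ?addr0 // => k ki.
by rewrite mxE (bit_string_at_neq _ 1 0 _ ki) bit_addKK mul0r.
Qed.

(** Only the diagonal blocks matter, since [eve_test] is block diagonal. The two signs combine into
    the bit at [i] because the phase inputs 0 and 1 differ only there. *)
Lemma phase_root_overlap v b e e' :
  entry ((phase_root 0)^t* *m phase_root 1 : Op R (_ * _)) (v, b, e) (v, b, e') =
  2 ^- (N - i.+1) *
    \sum_(p | prefix i (uword p) == v)
      sgn (uword p 0 i) * (amp p e' * (amp p e)^* ).
Proof.
rewrite entry_mul sum_pair (bigD1 b) //= [X in _ + X]big1 ?addr0; last first.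
  move=> c /negbTE cb; rewrite big1 // => p _.
  by rewrite entry_adj !entryE /= cb !mul0r conjC0 mul0r.
rewrite [X in _ = _ * X]big_mkcond mulr_sumr; apply: eq_bigr => p _.
rewrite entry_adj !entryE /= eqxx /=.
case: eqP => _; last by rewrite !mul0r !mulr0.
rewrite !mul1r !rmorphM /= suffix_weight_conj phase_signC.
by rewrite -(phase_sign01 b) -suffix_weight_sqr; ring.
Qed.

Lemma sum_suffix_weight : \sum_(b : suffix) 2 ^- (N - i.+1) = 1 :> C.
Proof.
have card_bits : #|{: suffix}| = (2 ^ (N - i.+1))%N by rewrite card_tuple card_ord.
by rewrite sumr_const card_bits -[LHS]mulr_natl natrX mulfV // expf_neq0 // pnatr_eq0.
Qed.

Lemma word_uword p u : (word p == u *m polar_mx n) = (uword p == u).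
Proof.
have GG := polar_mx_involutive n.
apply/eqP/eqP => [|<-]; rewrite /uword; first by move=> ->; rewrite -mulmxA GG mulmx1.
by rewrite -mulmxA GG mulmx1.
Qed.

Section Trace.
Variable D : 'rV[bit]_N -> Op R {ffun 'I_N -> E}.

(** The overlap of the purifications and Eve's bias are both expanded into this common sum over the
    basis labels [p]. *)
Let T p : C := sgn (uword p 0 i) *
  \sum_e \sum_e' entry (D (prefix i (uword p))) e' e * (amp p e * (amp p e')^* ).

Lemma tr_eve_test :
  \tr (eve_test D *m ((phase_root 0)^t* *m phase_root 1)) = \sum_p T p.
Proof.
rewrite tr_mul_entry sum_pair sum_pair.
transitivity (\sum_v \sum_(b : suffix) 2 ^- (N - i.+1) *
    \sum_(p | prefix i (uword p) == v) T p).
  apply: eq_bigr => v _; apply: eq_bigr => b _.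
  transitivity (\sum_e \sum_e' \sum_(p | prefix i (uword p) == v)
     2 ^- (N - i.+1) * (sgn (uword p 0 i) *
      (entry (D (prefix i (uword p))) e' e * (amp p e * (amp p e')^* )))).
    apply: eq_bigr => e _; rewrite sum_pair (bigD1 (v, b)) //=.
    rewrite [X in _ + X]big1 ?addr0; last first.
      move=> t /negbTE tv; rewrite big1 // => e' _.
      by rewrite entryE /= eq_sym tv !mul0r.
    apply: eq_bigr => e' _; rewrite entryE /= eqxx mul1r entry_tr.
    rewrite phase_root_overlap mulrCA !mulr_sumr; apply: eq_bigr => p /eqP ->.
    by congr (_ * _); rewrite mulrCA.
  transitivity (\sum_(p | prefix i (uword p) == v) \sum_e \sum_e'
     2 ^- (N - i.+1) * (sgn (uword p 0 i) *
      (entry (D (prefix i (uword p))) e' e * (amp p e * (amp p e')^* )))).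
    rewrite [RHS]exchange_big /=; apply: eq_bigr => e _.
    by rewrite [RHS]exchange_big.
  rewrite mulr_sumr; apply: eq_bigr => p _; rewrite /T !mulr_sumr.
  by apply: eq_bigr => e _; rewrite !mulr_sumr.
rewrite exchange_big /= (eq_bigr (fun=> 2 ^- (N - i.+1) * \sum_p T p)).
  by rewrite -mulr_suml sum_suffix_weight mul1r.
move=> b _; rewrite -mulr_sumr; congr (_ * _).
by rewrite [RHS](partition_big (fun p => prefix i (uword p)) xpredT).
Qed.

Lemma tr_eve_outputs :
  2 ^- N * \sum_(u : 'rV[bit]_N) sgn (u 0 i) *
    \tr (D (prefix i u) *m outputs sigma (u *m polar_mx n)) = \sum_p T p.
Proof.
rewrite (partition_big uword xpredT) //= mulr_sumr; apply: eq_bigr => u _.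
rewrite tr_mul_entry mulrCA.
transitivity (sgn (u 0 i) * \sum_e' \sum_e \sum_(p | uword p == u)
   entry (D (prefix i u)) e' e * (amp p e * (amp p e')^* )).
  rewrite mulr_sumr; congr (_ * _); apply: eq_bigr => e' _.
  rewrite mulr_sumr; apply: eq_bigr => e _; rewrite outputs_eveE.
  rewrite mulrCA mulKf ?expf_neq0 ?pnatr_eq0 // mulr_sumr.
  by apply: eq_bigl => p; rewrite word_uword.
transitivity (\sum_(p | uword p == u) sgn (u 0 i) * \sum_e \sum_e'
   entry (D (prefix i u)) e' e * (amp p e * (amp p e')^* )).
  rewrite -mulr_sumr; congr (_ * _); rewrite exchange_big [RHS]exchange_big /=.
  apply: eq_bigr => e _; rewrite [RHS]exchange_big /=.
  by apply: eq_bigr => e' _.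
by apply: eq_bigr => p /eqP <-.
Qed.

End Trace.

(** A prefix-controlled test on Eve's outputs has the same value as a test on the purifying side of
    the phase channel. Her bias towards [u 0 i] is thus an overlap of purifications of the two phase
    outputs, to which [re_tr_overlap] applies. *)
Lemma eve_bias_le_fidelity (D : 'rV[bit]_N -> Op R {ffun 'I_N -> E}) :
  (forall v, contraction (D v)) ->
  Re (2 ^- N * \sum_(u : 'rV[bit]_N) sgn (u 0 i) *
        \tr (D (prefix i u) *m outputs sigma (u *m polar_mx n))) <=
  Num.sqrt (fidelity (synth_phase W i)).
Proof.
move=> Dc; rewrite tr_eve_outputs -tr_eve_test.
have := re_tr_overlap (phase_root 0) (phase_root 1) (contraction_eve_test Dc).
rewrite !phase_root_gram => H; apply: le_trans H _.
by rewrite /fidelity sqrtr_sqr ler_norm.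
Qed.

End Synthesized.
End Uncertainty.

Lemma sqrtC_inv_gram (C : numClosedFieldType) (x : C) : 0 <= x ->
  (sqrtC x)^-1 * ((sqrtC x)^-1)^* = x^-1.
Proof.
by move=> x0; rewrite -normCK normfV ger0_norm ?sqrtC_ge0 // exprVn sqrtCK.
Qed.

(** * Purification of the wiretap channel *)

Section Wiretap.
Variable R : realType.
Local Notation C := R[i].
Local Notation Re := complex.Re.
Local Notation sgn := (@sgn R).

Definition coef (I : finType) (v : Ket R I) (x : I) : C := v (enum_rank x) 0.

Lemma coef_mul (I J : finType) (A : Lin R J I) (v : Ket R J) x :
  coef (A *m v) x = \sum_y entry A x y * coef v y.
Proof. by rewrite /coef mxE big_enum_rank. Qed.

Lemma coef_scale (I : finType) (c : C) (v : Ket R I) x :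
  coef (c *: v) x = c * coef v x.
Proof. by rewrite /coef mxE. Qed.

Lemma entry_pauliZX (x z z' : bit) :
  entry (pauliZ R ^+ (x : nat)) z z' = (z == z')%:R * sgn (x * z).
Proof.
case: x => [[|[|//]] lt] /=.
  rewrite expr0 entry_1; have -> : Ordinal lt = 0 :> bit by apply/val_inj.
  by rewrite mul0r sgn0 mulr1.
rewrite expr1 entryE; have -> : Ordinal lt = 1 :> bit by apply/val_inj.
by rewrite mul1r.
Qed.

Lemma coef_tens_mul (I J K L : finType) (A : Lin R J I) (B : Lin R L K)
    (v : Ket R (J * L)) x y :
  coef (tens A B *m v) (x, y) =
  \sum_x' entry A x x' * \sum_y' entry B y y' * coef v (x', y').
Proof.
rewrite coef_mul sum_pair; apply: eq_bigr => x' _; rewrite mulr_sumr.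
by apply: eq_bigr => y' _; rewrite entry_tens mulrA.
Qed.

Lemma sum_delta_l (I : finType) (x : I) (F : I -> C) :
  \sum_y (x == y)%:R * F y = F x.
Proof.
rewrite (bigD1 x) //= eqxx mul1r big1 ?addr0 // => y /negbTE yx.
by rewrite eq_sym yx mul0r.
Qed.

Lemma coef_tens_id_l (I J K : finType) (A : Lin R J I) (v : Ket R (K * J)) x y :
  coef (tens (1%:M : Op R K) A *m v) (x, y) = \sum_y' entry A y y' * coef v (x, y').
Proof.
rewrite coef_tens_mul.
rewrite (eq_bigr (fun x' => (x == x')%:R * \sum_y' entry A y y' * coef v (x', y'))).
  by rewrite sum_delta_l.
by move=> x' _; rewrite entry_1.
Qed.

Lemma coef_tens_id_r (I J K : finType) (A : Lin R J I) (v : Ket R (J * K)) x y :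
  coef (tens A (1%:M : Op R K) *m v) (x, y) = \sum_x' entry A x x' * coef v (x', y).
Proof.
rewrite coef_tens_mul; apply: eq_bigr => x' _; congr (_ * _).
rewrite (eq_bigr (fun y' => (y == y')%:R * coef v (x', y'))).
  by rewrite sum_delta_l.
by move=> y' _; rewrite entry_1.
Qed.

Lemma coef_phase_input (S1 : finType) (psi : bit -> Ket R (bit * S1)) z y :
  coef (phase_input psi) (z, y) = (sqrtC 2)^-1 * coef (psi z) y.
Proof.
rewrite coef_scale /coef summxE; congr (_ * _).
rewrite (eq_bigr (fun z' => (z == z')%:R * coef (psi z') y)) ?sum_delta_l //.
by move=> z' _; rewrite mxE enum_rankK /= entry_ket.
Qed.

Variables (B E S1 S2 : finType).
Variables (N : Op R bit -> Op R (B * E)) (U : Lin R bit (B * E * S2)).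
Variables (rho : bit -> Op R bit) (psi : bit -> Ket R (bit * S1)).
Hypothesis UN : isometric_extension U N.
Hypothesis psi_rho : forall z, purification (psi z) (rho z).

Definition bob_bit (p : B * bit * S1 * S2) : bit := p.1.1.2.

Definition dilated (z : bit) : Ket R (B * E * S2 * S1) :=
  tens U (1%:M : Op R S1) *m psi z.

(** The amplitudes [th] of this channel: [p] gathers [B], [C], [S1], [S2], and the prefactor comes
    from the uniform superposition on [C]. *)
Definition wiretap_amp (p : B * bit * S1 * S2) (e : E) : C :=
  (sqrtC 2)^-1 * coef (dilated p.1.1.2) (p.1.1.1, e, p.2, p.1.2).

Lemma phase_bobE x p q : entry (phase_bob U psi x) p q =
  sgn (x * (bob_bit p + bob_bit q)) *
  \sum_e wiretap_amp p e * (wiretap_amp q e)^*.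
Proof.
set V := tens (1%:M : Op R bit) (tens U (1%:M : Op R S1)) *m
         tens (pauliZ R ^+ (x : nat)) (1%:M : Op R (bit * S1)) *m phase_input psi.
have VE z w : coef V (z, w) = sgn (x * z) * ((sqrtC 2)^-1 * coef (dilated z) w).
  rewrite /V -mulmxA coef_tens_id_l /dilated [coef (_ *m psi z) w]coef_mul.
  rewrite !mulr_sumr; apply: eq_bigr => y _; rewrite coef_tens_id_r.
  rewrite (eq_bigr (fun z' => (z == z')%:R *
     (sgn (x * z) * coef (phase_input psi) (z', y)))).
    rewrite sum_delta_l coef_phase_input; ring.
  by move=> z' _; rewrite entry_pauliZX mulrA.
case: p q => [[[b c] s1] s2] [[[b' c'] s1'] s2'].
rewrite /phase_bob entryE mulr_sumr; apply: eq_bigr => e _.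
rewrite entry_ketbra -!/(coef _ _) -/V !VE mulrDr sgnD rmorphM /= sgnC.
rewrite /wiretap_amp /bob_bit /=; ring.
Qed.

Lemma rhoE z a a' : entry (rho z) a a' =
  \sum_s coef (psi z) (a, s) * (coef (psi z) (a', s))^*.
Proof.
rewrite -(psi_rho z) entryE; apply: eq_bigr => s _.
by rewrite entry_ketbra.
Qed.

Lemma dilatedE z w s : coef (dilated z) (w, s) =
  \sum_a entry U w a * coef (psi z) (a, s).
Proof. exact: coef_tens_id_r. Qed.

Lemma dilated_gram z w w' : entry (U *m rho z *m U^t* : Op R _) w w' =
  \sum_s coef (dilated z) (w, s) * (coef (dilated z) (w', s))^*.
Proof.
rewrite entry_mul.
transitivity (\sum_a' \sum_a \sum_s
  (entry U w a * coef (psi z) (a, s)) * (entry U w' a' * coef (psi z) (a', s))^* ).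
  apply: eq_bigr => a' _; rewrite entry_mul mulr_suml; apply: eq_bigr => a _.
  rewrite rhoE mulr_sumr mulr_suml; apply: eq_bigr => s _.
  by rewrite entry_adj rmorphM /=; ring.
rewrite exchange_big /=.
under eq_bigr => a _ do rewrite exchange_big /=.
rewrite exchange_big /=; apply: eq_bigr => s _.
rewrite !dilatedE rmorph_sum mulr_suml; apply: eq_bigr => a _.
by rewrite mulr_sumr.
Qed.

(** Fixing [C] at [z] selects [psi z], and summing over the rest traces out [B], [S1] and [S2]; the
    factor 2 cancels the squared normalization of the superposition. *)
Lemma channel_eveE z e e' : entry (channel_eve N (rho z)) e e' =
  2 * \sum_(p | bob_bit p == z) wiretap_amp p e * (wiretap_amp p e')^*.
Proof.
rewrite entryE UN.2.
transitivity (\sum_b \sum_s1 \sum_s2 coef (dilated z) (b, e, s2, s1) *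
    (coef (dilated z) (b, e', s2, s1))^* ).
  apply: eq_bigr => b _; rewrite entryE exchange_big /=; apply: eq_bigr => s2 _.
  by rewrite dilated_gram.
rewrite [X in _ = _ * X]big_mkcond !sum_pair mulr_sumr; apply: eq_bigr => b _.
rewrite (bigD1 z) //= [X in _ * (_ + X)]big1 ?addr0; last first.
  move=> c /negbTE cz; rewrite big1 // => s1 _; rewrite big1 // => s2 _.
  by rewrite /bob_bit /= cz.
rewrite mulr_sumr; apply: eq_bigr => s1 _; rewrite mulr_sumr.
apply: eq_bigr => s2 _; rewrite /bob_bit /wiretap_amp /= eqxx rmorphM /=.
set x := coef _ _; set y := coef _ _.
have -> : 2 * ((sqrtC 2)^-1 * x * (((sqrtC 2)^-1)^* * y^* )) =
   2 * ((sqrtC 2)^-1 * ((sqrtC 2)^-1)^* ) * (x * y^* ) :> C by ring.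
by rewrite sqrtC_inv_gram ?ler0n // mulfV ?mul1r // pnatr_eq0.
Qed.

Lemma tr_channel_eve z : cptp N -> density (rho z) ->
  \tr (channel_eve N (rho z)) = 1.
Proof.
move=> [_ _ Ntr] [_ rho1]; rewrite -rho1 -[RHS]Ntr !tr_entry sum_pair.
rewrite exchange_big /=; apply: eq_bigr => e _.
by rewrite entryE.
Qed.

End Wiretap.

(** * Tensor products and additivity of the entropy *)

Section TensorEntropy.
Variable R : realType.
Local Notation C := R[i].
Local Notation Re := complex.Re.

Lemma tens_mul (I J K I' J' K' : finType) (A : Lin R J I) (B : Lin R K J)
    (A' : Lin R J' I') (B' : Lin R K' J') :
  tens A A' *m tens B B' = tens (A *m B) (A' *m B').
Proof.
apply: entryP => x y; rewrite entry_mul entry_tens !entry_mul sum_pair mulr_suml.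
apply: eq_bigr => z _; rewrite mulr_sumr; apply: eq_bigr => z' _.
by rewrite !entry_tens mulrACA.
Qed.

Lemma tens_adj (I J I' J' : finType) (A : Lin R J I) (A' : Lin R J' I') :
  (tens A A')^t* = tens (A^t* ) (A'^t* ) :> Lin R _ _.
Proof.
by apply: entryP => x y; rewrite entry_adj !entry_tens !entry_adj rmorphM.
Qed.

Lemma tens_1 (I J : finType) : tens (1%:M : Op R I) (1%:M : Op R J) = 1%:M.
Proof.
by apply: entryP => -[x x'] [y y']; rewrite entry_tens !entry_1 -natrM mulnb.
Qed.

Lemma tens_unitary (I J : finType) (P : Op R I) (Q : Op R J) :
  P \is unitarymx -> Q \is unitarymx -> tens P Q \is unitarymx.
Proof.
move=> /unitarymxP Pu /unitarymxP Qu; apply/unitarymxP.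
by rewrite tens_adj tens_mul Pu Qu tens_1.
Qed.

Definition row_tens (I J : finType) (p : 'rV[R]_#|{: I}|) (q : 'rV[R]_#|{: J}|) :
    'rV[R]_#|{: I * J}| :=
  \row_k (p 0 (enum_rank (enum_val k).1) * q 0 (enum_rank (enum_val k).2)).

Lemma row_tensE (I J : finType) (p : 'rV[R]_#|{: I}|) (q : 'rV[R]_#|{: J}|) x y :
  row_tens p q 0 (enum_rank (x, y)) = p 0 (enum_rank x) * q 0 (enum_rank y).
Proof. by rewrite mxE enum_rankK. Qed.

Lemma entry_rdiag (I : finType) (d : 'rV[R]_#|{: I}|) (x y : I) :
  entry (rdiag d : Op R I) x y = (d 0 (enum_rank x))%:C%C *+ (x == y).
Proof. by rewrite /entry !mxE (inj_eq enum_rank_inj). Qed.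

Lemma tens_udiag (I J : finType) (P : Op R I) (Q : Op R J) p q :
  tens (udiag P p : Op R I) (udiag Q q : Op R J) =
  udiag (tens P Q : Op R (I * J)) (row_tens p q) :> Op R (I * J).
Proof.
have rdiag_tens : rdiag (row_tens p q) = tens (rdiag p : Op R I) (rdiag q : Op R J).
  apply: entryP => -[x x'] [y y']; rewrite entry_tens !entry_rdiag row_tensE /=.
  rewrite xpair_eqE rmorphM; case: (x == y); case: (x' == y');
    by rewrite ?mulr1n ?mulr0n ?mulr0 ?mul0r.
by rewrite /udiag rdiag_tens tens_adj !tens_mul.
Qed.

Lemma posmx_tens (I J : finType) (A : Op R I) (B : Op R J) :
  posmx A -> posmx B -> posmx (tens A B).
Proof.
move=> /posmx_spectrum [P [p [Pu -> p0]]] /posmx_spectrum [Q [q [Qu -> q0]]].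
rewrite tens_udiag; apply: posmx_udiag => k.
by rewrite mxE mulr_ge0.
Qed.

Lemma mul_ln_mul (x y : R) : 0 <= x -> 0 <= y ->
  x * y * ln (x * y) = y * (x * ln x) + x * (y * ln y).
Proof.
rewrite le_eqVlt => /predU1P[<-|x0]; first by rewrite !(mul0r, mulr0) addr0.
rewrite le_eqVlt => /predU1P[<-|y0]; first by rewrite !(mul0r, mulr0) addr0.
by rewrite lnM ?posrE //; ring.
Qed.

(** The spectrum of the product consists of the products [p q], and [p q ln (p q)] splits even when
    a factor is zero. This makes the mutual information a single entropy difference, between the
    joint state and the product of its marginals. *)
Lemma re_tr_ln_tens (I J : finType) (A : Op R I) (B : Op R J) :
  posmx A -> posmx B -> Re (\tr A) = 1 -> Re (\tr B) = 1 ->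
  Re (\tr (tens A B *m mxfun (@ln R) (tens A B))) =
  Re (\tr (A *m mxfun (@ln R) A)) + Re (\tr (B *m mxfun (@ln R) B)).
Proof.
move=> /posmx_spectrum [P [p [Pu -> p0]]] /posmx_spectrum [Q [q [Qu -> q0]]].
rewrite [X in X = 1 -> _](re_tr_udiag p Pu) [X in _ -> X = 1 -> _](re_tr_udiag q Qu).
move=> p1 q1; rewrite tens_udiag.
rewrite [LHS](re_tr_mxfun _ (@ln R) (tens_unitary Pu Qu)).
rewrite [X in _ = X + _](re_tr_mxfun p (@ln R) Pu).
rewrite [X in _ = _ + X](re_tr_mxfun q (@ln R) Qu).
move: p1 q1; rewrite !big_enum_rank sum_pair => p1 q1.
transitivity (\sum_x \sum_y
   (q 0 (enum_rank y) * (p 0 (enum_rank x) * ln (p 0 (enum_rank x))) +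
    p 0 (enum_rank x) * (q 0 (enum_rank y) * ln (q 0 (enum_rank y))))).
  apply: eq_bigr => x _; apply: eq_bigr => y _.
  by rewrite !row_tensE mul_ln_mul.
under eq_bigr => x _ do rewrite big_split /= -mulr_suml -mulr_sumr q1 mul1r.
by rewrite big_split /= -mulr_suml p1 mul1r.
Qed.

Lemma entropyE n (A : 'M[C]_n) : A^t* = A ->
  entropy A = - (Re (\tr (A *m mxfun (@ln R) A)) / ln 2).
Proof.
move=> /hermitian_udiag ->; set P := spectralmx A; set d := map_mx _ _.
have Pu : P \is unitarymx := spectral_unitarymx A.
rewrite /entropy [X in - X](re_tr_mxfun d (@log2 R) Pu).
rewrite [X in - (X / _)](re_tr_mxfun d (@ln R) Pu) mulr_suml; congr (- _).
by apply: eq_bigr => k _; rewrite /log2 mulrA.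
Qed.

End TensorEntropy.

(** * From single-bit biases to the mutual information *)

Section Hybrid.
Variables (R : realType) (N : nat).
Local Notation word := 'rV[bit]_N.

Definition rsgn (x : bit) : R := (-1) ^+ (x : nat).

Lemma prefix0 (u : word) : prefix 0 u = 0.
Proof. by apply/rowP => k; rewrite !mxE. Qed.

Lemma prefix_full (u : word) : prefix N u = u.
Proof. by apply/rowP => k; rewrite !mxE ltn_ord. Qed.

Lemma prefixS (j : 'I_N) (u : word) :
  prefix j.+1 u = prefix j u + u 0 j *: delta_mx 0 j.
Proof.
apply/rowP => k; rewrite !mxE eqxx /= ltnS leq_eqVlt val_eqE.
by have [->|_] := eqVneq k j; rewrite ?ltnn ?add0r ?mulr1 ?mulr0 ?addr0.
Qed.

Lemma prefix_delta (j : 'I_N) : prefix j.+1 (delta_mx 0 j : word) = delta_mx 0 j.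
Proof.
apply/rowP => k; rewrite !mxE eqxx /=; case: ltnP => //.
by case: eqP => // ->; rewrite ltnn.
Qed.

(* In characteristic 2, [u' + prefix j u'] is the part of u' from j on. *)
Definition hybrid (F : word -> word -> R) (j : nat) : R :=
  \sum_(u : word) \sum_(u' : word) F (prefix j u + (u' + prefix j u')) u.

(** Pairing each [u] with its flip at [j] makes that bit uniform, as [t] does not see it. *)
Lemma sum_resample_bit (j : 'I_N) (t : word -> word) (g : bit -> word -> R) :
  (forall u, t (u + delta_mx 0 j) = t u) ->
  2 * \sum_(u : word) g (u 0 j) (t u) = \sum_(u : word) (g 0 (t u) + g 1 (t u)).
Proof.
move=> tE; rewrite mulr_natl mulr2n.
rewrite {2}(reindex_inj (addIr (delta_mx 0 j : word))) -big_split /=.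
apply: eq_bigr => u _; rewrite tE !mxE !eqxx /=.
case: (u 0 j) => [[|[|//]] lt]; last rewrite addrC; congr (g _ _ + g _ _);
  exact/val_inj.
Qed.

(** Consecutive hybrids differ only in bit [j], true in one and fresh in the other, and [f(u_j) -
    (f(0) + f(1)) / 2 = (-1)^(u_j) (f(0) - f(1)) / 2]. The fresh tail is summed outside, so that
    each inner sum is a bias of the true bit. *)
Lemma hybrid_step (F : word -> word -> R) (j : 'I_N) :
  2 * (hybrid F j.+1 - hybrid F j) =
  \sum_(u' : word) \sum_(u : word) rsgn (u 0 j) *
    (F (prefix j u + (u' + prefix j.+1 u')) u -
     F (prefix j u + delta_mx 0 j + (u' + prefix j.+1 u')) u).
Proof.
have H0 : 2 * hybrid F j = \sum_(u : word) \sum_(u' : word)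
    (F (prefix j u + (u' + prefix j.+1 u')) u +
     F (prefix j u + delta_mx 0 j + (u' + prefix j.+1 u')) u).
  rewrite /hybrid mulr_sumr; apply: eq_bigr => u _.
  have := @sum_resample_bit j (fun u' => u' + prefix j.+1 u')
    (fun x s => F (prefix j u + x *: delta_mx 0 j + s) u).
  rewrite scale0r scale1r addr0 => <-; last first.
    by move=> u'; rewrite prefixD addrACA prefix_delta rV_bit_addKK addr0.
  congr (_ * _); apply: eq_bigr => u' _; congr (F _ _).
  rewrite -addrA; congr (_ + _); rewrite prefixS [RHS]addrC -!addrA.
  by rewrite rV_bit_addKK addr0.
have H1 : 2 * hybrid F j.+1 = \sum_(u : word) \sum_(u' : word)
    2 * F (prefix j u + u 0 j *: delta_mx 0 j + (u' + prefix j.+1 u')) u.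
  rewrite /hybrid mulr_sumr; apply: eq_bigr => u _; rewrite mulr_sumr.
  by apply: eq_bigr => u' _; rewrite {1}prefixS.
rewrite mulrBr H0 H1 -sumrB [RHS]exchange_big /=; apply: eq_bigr => u _.
rewrite -sumrB; apply: eq_bigr => u' _; rewrite /rsgn.
case: (u 0 j) => [[|[|//]] lt] /=.
  have -> : Ordinal lt = 0 :> bit by exact/val_inj.
  by rewrite scale0r addr0; ring.
have -> : Ordinal lt = 1 :> bit by exact/val_inj.
by rewrite scale1r; ring.
Qed.

Lemma sum_word_const (c : R) : \sum_(u : word) c = 2 ^+ N * c.
Proof.
have card_word : #|{: word}| = (2 ^ N)%N by rewrite card_mx mul1n card_ord.
by rewrite sumr_const card_word -[LHS]mulr_natl natrX.
Qed.

(** Hybrid [N] feeds the same word twice, hybrid 0 two independent ones. Steps outside [A] vanish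
    because [F] ignores those bits; in a step inside [A] the tail [t] is an arbitrary constant. *)
Lemma hybrid_telescope (F : word -> word -> R) (A : {set 'I_N}) (d : 'I_N -> R) :
  (forall (j : 'I_N) w u, j \notin A -> F (w + delta_mx 0 j) u = F w u) ->
  (forall (j : 'I_N) t, j \in A ->
    \sum_(u : word) rsgn (u 0 j) *
      (F (prefix j u + t) u - F (prefix j u + delta_mx 0 j + t) u) <=
    2 * (2 ^+ N * d j)) ->
  2 ^- N * \sum_(u : word) F u u -
  2 ^- N * (2 ^- N * \sum_(u : word) \sum_(u' : word) F u' u) <=
  \sum_(j in A) d j.
Proof.
move=> HnA HA.
have p2 : (0 : R) < 2 ^+ N by rewrite exprn_gt0.
have hN : hybrid F N = 2 ^+ N * \sum_(u : word) F u u.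
  rewrite /hybrid mulr_sumr; apply: eq_bigr => u _.
  rewrite -sum_word_const; apply: eq_bigr => u' _.
  by rewrite !prefix_full rV_bit_addKK addr0.
have h0 : hybrid F 0 = \sum_(u : word) \sum_(u' : word) F u' u.
  by apply: eq_bigr => u _; apply: eq_bigr => u' _; rewrite !prefix0 addr0 add0r.
have step (j : 'I_N) : hybrid F j.+1 - hybrid F j <=
    2 ^+ N * 2 ^+ N * (if j \in A then d j else 0).
  rewrite -(ler_pM2l (x := 2)) // hybrid_step; case: ifPn => jA; last first.
    rewrite mulr0 mulr0 big1 // => u' _; rewrite big1 // => u _.
    by rewrite addrAC HnA // subrr mulr0.
  apply: le_trans (ler_sum _ (fun u' _ => HA j (u' + prefix j.+1 u') jA)) _.
  by rewrite sum_word_const le_eqVlt; apply/orP; left; apply/eqP; ring.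
have tel : hybrid F N - hybrid F 0 <= 2 ^+ N * 2 ^+ N * \sum_(j in A) d j.
  rewrite -(telescope_sumr _ (leq0n N)) big_mkord [X in _ <= _ * X]big_mkcond mulr_sumr.
  by apply: ler_sum => j _; apply: step.
move: tel; rewrite hN h0 -(ler_pM2l (x := 2 ^- N * 2 ^- N)) ?mulr_gt0 ?invr_gt0 //.
set a := \sum_u F u u; set b := \sum_u \sum_u' _; set s := \sum_(j in A) _.
have q0 : 2 ^+ N != 0 :> R by rewrite gt_eqF.
have -> : 2 ^- N * 2 ^- N * (2 ^+ N * a - b) = 2 ^- N * a - 2 ^- N * (2 ^- N * b).
  by rewrite mulrBr -!mulrA (mulKf q0).
have -> : 2 ^- N * 2 ^- N * (2 ^+ N * 2 ^+ N * s) = s.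
  by rewrite -!mulrA !(mulKf q0).
by [].
Qed.

End Hybrid.

Section Secrecy.
Variable R : realType.
Local Notation C := R[i].
Local Notation Re := complex.Re.

Lemma quadZ n (r : R) (A : 'M[C]_n) v : quad (r%:C%C *: A) v = r * quad A v.
Proof. by rewrite /quad -scalemxAr -scalemxAl mxE reZ. Qed.

Lemma posmxZ n (r : R) (A : 'M[C]_n) : 0 <= r -> posmx A -> posmx (r%:C%C *: A).
Proof.
move=> r0 [Ah A0]; split=> [|v]; last by rewrite quadZ mulr_ge0.
rewrite -[in RHS]Ah; apply/matrixP => i j; rewrite !mxE rmorphM; congr (_ * _).
by apply/CrealP; rewrite complex_real.
Qed.

Lemma posmx_sum n (T : finType) (F : T -> 'M[C]_n) :
  (forall t, posmx (F t)) -> posmx (\sum_t F t).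
Proof.
move=> F0; apply: (big_ind (@posmx R n)) => [|A B|t _].
- split=> [|v]; last by rewrite /quad mulmx0 mul0mx mxE.
  by apply/matrixP => i j; rewrite !mxE conjC0.
- exact: posmxD.
exact: F0.
Qed.

Lemma posmx_average n (T : finType) k (F : T -> 'M[C]_n) :
  (forall t, posmx (F t)) -> posmx (2 ^- k *: \sum_t F t).
Proof.
move=> F0; have -> : 2 ^- k = (2 ^- k)%:C%C :> C.
  by rewrite /= fmorphV rmorphXn /= rmorph_nat.
by apply: posmxZ; rewrite ?invr_ge0 ?exprn_ge0 //; apply: posmx_sum.
Qed.

Lemma contractionN m n (K : 'M[C]_(m, n)) : contraction K -> contraction (- K).
Proof.
move=> Kc v; apply: le_trans (Kc v); apply: ler_sum => i _.
by rewrite mulNmx mxE !sqn_sum_squares; case: (_ i 0) => a b /=; rewrite !sqrrN.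
Qed.

(** The test that [V] performs on the second system once the first is known to be in state [a]. *)
Definition corner (I J : finType) (V : Op R (I * J)) (a : I) : Op R J :=
  of_entries (fun e e' => entry V (a, e) (a, e')).

Lemma contraction_corner (I J : finType) (V : Op R (I * J)) a :
  contraction V -> contraction (corner V a).
Proof.
(* [T] is the isometry that attaches [a], and the corner is the compression of [V] by it. *)
move=> Vc; pose T : Lin R J (I * J) := of_entries (fun x e => (x == (a, e))%:R).
have TT : (T^t* : Lin R (I * J) J) *m T = 1%:M.
  apply: entryP => e e'; rewrite entry_mul entry_1 (bigD1 (a, e)) //=.
  rewrite big1 ?addr0; last first.
    by move=> x /negbTE xe; rewrite entry_adj !entryE xe conjC0 mul0r.
  by rewrite entry_adj !entryE !xpair_eqE !eqxx conjC1 mul1r /= eq_sym.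
have Tc : contraction T.
  by move=> v; rewrite [leLHS]nrm2E adjM -mulmxA [_ *m (T *m v)]mulmxA TT mul1mx -nrm2E.
have -> : corner V a = T^t* *m V *m T.
  apply: entryP => e e'; rewrite entryE entry_mul (bigD1 (a, e')) //=.
  rewrite [X in _ + X]big1 ?addr0; last first.
    by move=> x /negbTE xe; rewrite [entry T _ _]entryE xe mulr0.
  rewrite [entry T _ _]entryE eqxx mulr1 entry_mul (bigD1 (a, e)) //=.
  rewrite [X in _ + X]big1 ?addr0; last first.
    by move=> x /negbTE xe; rewrite entry_adj entryE xe conjC0 mul0r.
  by rewrite entry_adj [entry T _ _]entryE eqxx conjC1 mul1r.
by apply: contraction_mul => //; apply: contraction_mul => //; apply: contraction_adj.
Qed.

Lemma tr_mul_tens_ket (I J : finType) (V : Op R (I * J)) a (X : Op R J) :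
  \tr (V *m tens (ketbra (ket R a)) X) = \tr (corner V a *m X).
Proof.
rewrite !tr_mul_entry sum_pair (bigD1 a) //= [X in _ + X]big1 ?addr0; last first.
  move=> b /negbTE ba; rewrite big1 // => e _; rewrite big1 // => -[c e'] _.
  by rewrite entry_tens entry_ketbra_ket /= ba andbF mul0r mulr0.
apply: eq_bigr => e _; rewrite sum_pair (bigD1 a) //= [X in _ + X]big1 ?addr0; last first.
  move=> b /negbTE ba; rewrite big1 // => e' _.
  by rewrite entry_tens entry_ketbra_ket /= ba mul0r mulr0.
apply: eq_bigr => e' _.
by rewrite entry_tens entry_ketbra_ket !eqxx mul1r entryE.
Qed.

Lemma tr_tens (I J : finType) (A : Op R I) (B : Op R J) :
  \tr (tens A B) = \tr A * \tr B.
Proof.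
rewrite !tr_entry sum_pair mulr_suml; apply: eq_bigr => x _.
by rewrite mulr_sumr; apply: eq_bigr => y _; rewrite entry_tens.
Qed.

Lemma tr_ketbra_ket (I : finType) (a : I) : \tr (ketbra (ket R a)) = 1.
Proof.
rewrite tr_entry (bigD1 a) //= entry_ketbra_ket eqxx big1 ?addr0 // => b /negbTE ba.
by rewrite entry_ketbra_ket ba.
Qed.

Lemma tens_averages (I J S T : finType) (c d : C) (F : S -> Op R I) (G : T -> Op R J) :
  tens (c *: \sum_s F s : Op R I) (d *: \sum_t G t : Op R J) =
  d *: \sum_t c *: \sum_s tens (F s) (G t) :> Op R (I * J).
Proof.
apply: entryP => x y; rewrite entry_tens !entry_scale !entry_sum.
rewrite mulrCA mulr_sumr; congr (_ * _); apply: eq_bigr => t _.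
rewrite entry_scale entry_sum -mulrA mulr_suml; congr (_ * _).
by apply: eq_bigr => s _; rewrite entry_tens.
Qed.

Lemma re_average (T : finType) k (F : T -> C) :
  Re (2 ^- k * \sum_t F t) = 2 ^- k * \sum_t Re (F t).
Proof.
have -> : 2 ^- k = (2 ^- k)%:C%C :> C.
  by rewrite /= fmorphV rmorphXn /= rmorph_nat.
by rewrite reZ re_sum.
Qed.

Variables (I E : finType) (col : I -> bit) (th : I -> E -> C).
Variables (W : bit -> Op R I) (sigma : bit -> Op R E).
Hypothesis WE : forall x p q,
  entry (W x) p q = @sgn R (x * (col p + col q)) * \sum_e th p e * (th q e)^*.
Hypothesis sigmaE : forall z e e',
  entry (sigma z) e e' = 2 * \sum_(p | col p == z) th p e * (th p e')^*.
Hypothesis sigma1 : forall z, \tr (sigma z) = 1.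

Lemma posmx_outputs N (z : 'rV[bit]_N) : posmx (outputs sigma z).
Proof.
pose M : Lin R {ffun 'I_N -> I} {ffun 'I_N -> E} :=
  of_entries (fun e p => (word col p == z)%:R * amp th p e).
have -> : outputs sigma z = (2 ^+ N)%:C%C *: (M *m M^t* ).
  apply: entryP => e e'; rewrite (outputs_eveE sigmaE) entry_scale entry_mul.
  rewrite [in RHS]rmorphXn /= rmorph_nat big_mkcond; congr (_ * _).
  apply: eq_bigr => p _; rewrite entry_adj !entryE.
  by case: eqP => _; rewrite ?mul1r ?mul0r.
by apply: posmxZ; [rewrite exprn_ge0 | apply: posmx_gram].
Qed.

Lemma tr_outputs N (z : 'rV[bit]_N) : \tr (outputs sigma z) = 1.
Proof.
rewrite tr_entry (eq_bigr (fun e : {ffun 'I_N -> E} =>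
   \prod_k entry (sigma (z 0 k)) (e k) (e k))); last first.
  by move=> e _; rewrite entry_outputs.
rewrite -(bigA_distr_bigA (fun k e => entry (sigma (z 0 k)) e e)) /=.
by apply: big1 => k _; rewrite -tr_entry sigma1.
Qed.

Section Block.
Variables (n : nat) (A : {set 'I_(2 ^ n)}).
Local Notation N := (2 ^ n)%N.
Local Notation known u := (colsub (@enum_val _ (mem A)) u).
Local Notation eve u := (outputs sigma (u *m polar_mx n)).
Let state := wiretap_state sigma A.

Lemma average_1 : 2 ^- N * \sum_(u : 'rV[bit]_N) 1 = 1 :> C.
Proof.
have card_word : #|{: 'rV[bit]_N}| = (2 ^ N)%N by rewrite card_mx mul1n card_ord.
by rewrite sumr_const card_word natrX mulVf // expf_neq0 // pnatr_eq0.
Qed.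

Lemma wiretap_bits : ptrace_r state =
  2 ^- N *: \sum_(u : 'rV[bit]_N) ketbra (ket R (known u)).
Proof.
apply: entryP => a a'; rewrite entryE entry_scale entry_sum.
under eq_bigr => e _ do rewrite entry_scale entry_sum.
rewrite -mulr_sumr exchange_big; congr (_ * _); apply: eq_bigr => u _ /=.
under eq_bigr => e _ do rewrite entry_tens /=.
by rewrite -mulr_sumr -tr_entry tr_outputs mulr1.
Qed.

Lemma wiretap_eve : ptrace_l state = 2 ^- N *: \sum_(u : 'rV[bit]_N) eve u.
Proof.
apply: entryP => e e'; rewrite entryE entry_scale entry_sum.
under eq_bigr => a _ do rewrite entry_scale entry_sum.
rewrite -mulr_sumr exchange_big; congr (_ * _); apply: eq_bigr => u _ /=.
under eq_bigr => a _ do rewrite entry_tens /=.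
by rewrite -mulr_suml -tr_entry tr_ketbra_ket mul1r.
Qed.

Lemma posmx_wiretap_state : posmx state.
Proof.
apply: posmx_average => u; apply: posmx_tens; first exact: posmx_gram.
exact: posmx_outputs.
Qed.

Lemma posmx_wiretap_bits : posmx (ptrace_r state).
Proof. by rewrite wiretap_bits; apply: posmx_average => u; apply: posmx_gram. Qed.

Lemma posmx_wiretap_eve : posmx (ptrace_l state).
Proof. by rewrite wiretap_eve; apply: posmx_average => u; apply: posmx_outputs. Qed.

Lemma re_tr_average (T : finType) m k (F : T -> 'M[C]_m) :
  Re (\tr (2 ^- k *: \sum_t F t)) = 2 ^- k * \sum_t Re (\tr (F t)).
Proof. by rewrite mxtraceZ raddf_sum re_average. Qed.

Lemma re_average_1 : 2 ^- N * \sum_(u : 'rV[bit]_N) 1 = 1 :> R.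
Proof. by have := congr1 (@complex.Re R) average_1; rewrite re_average. Qed.

Lemma tr_wiretap_bits : Re (\tr (ptrace_r state)) = 1.
Proof.
rewrite wiretap_bits re_tr_average -[RHS]re_average_1; congr (_ * _).
by apply: eq_bigr => u _; rewrite tr_ketbra_ket.
Qed.

Lemma tr_wiretap_eve : Re (\tr (ptrace_l state)) = 1.
Proof.
rewrite wiretap_eve re_tr_average -[RHS]re_average_1; congr (_ * _).
by apply: eq_bigr => u _; rewrite tr_outputs.
Qed.

Lemma tr_wiretap_state : Re (\tr state) = 1.
Proof.
rewrite re_tr_average -[RHS]re_average_1; congr (_ * _).
by apply: eq_bigr => u _; rewrite tr_tens tr_ketbra_ket tr_outputs mul1r.
Qed.

Lemma tr_state_test V :
  Re (\tr (V *m state)) =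
  2 ^- N * \sum_(u : 'rV[bit]_N) Re (\tr (corner V (known u) *m eve u)).
Proof.
rewrite /state /wiretap_state -scalemxAr mulmx_sumr re_tr_average; congr (_ * _).
by apply: eq_bigr => u _; rewrite tr_mul_tens_ket.
Qed.

Lemma tr_product_test V :
  Re (\tr (V *m tens (ptrace_r state) (ptrace_l state))) =
  2 ^- N * (2 ^- N * \sum_(u : 'rV[bit]_N) \sum_(u' : 'rV[bit]_N)
     Re (\tr (corner V (known u') *m eve u))).
Proof.
rewrite wiretap_bits wiretap_eve tens_averages -scalemxAr mulmx_sumr re_tr_average.
congr (_ * _); rewrite mulr_sumr; apply: eq_bigr => u _.
rewrite -scalemxAr mulmx_sumr re_tr_average; congr (_ * _).
by apply: eq_bigr => u' _; rewrite tr_mul_tens_ket.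
Qed.

Lemma known_flip (j : 'I_N) (w : 'rV[bit]_N) :
  j \notin A -> known (w + delta_mx 0 j) = known w.
Proof.
move=> jA; apply/rowP => k; rewrite !mxE eqxx /=.
by case: eqP => [kj|_]; rewrite ?addr0 //; move: jA; rewrite -kj enum_valP.
Qed.

Lemma re_sgn_mul x (z : C) : Re (@sgn R x * z) = rsgn R x * Re z.
Proof. by rewrite -reZ; congr (Re (_ * _)); rewrite rmorphXn rmorphN1. Qed.

Lemma test_bound V : contraction V ->
  Re (\tr (V *m (state - tens (ptrace_r state) (ptrace_l state)))) <=
  \sum_(j in A) Num.sqrt (fidelity (synth_phase W j)).
Proof.
move=> Vc; rewrite mulmxBr raddfB reD reN tr_state_test tr_product_test.
(* [w] supplies the bits in the register and [u] the word sent: equal arguments give the joint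
   state, independent ones the product of the marginals. *)
pose F w u := Re (\tr (corner V (known w) *m eve u)).
apply: (@hybrid_telescope R N F A) => [j w u jA|j t jA].
  by rewrite /F known_flip.
(* For a fixed tail [t] the two values of bit [j] select two corners; their halved difference
   depends on [u] only through its first [j] bits, as [eve_bias_le_fidelity] requires. *)
pose D v := (2^-1)%:C%C *: (corner V (known (v + t)) -
                           corner V (known (v + delta_mx 0 j + t))).
have Dc v : contraction (D v).
  by apply: contraction_halfB; apply: contraction_corner.
have := eve_bias_le_fidelity WE sigmaE j Dc; rewrite re_average.
set f := Num.sqrt _ => H.
have p2 : (0 : R) < 2 ^+ N by rewrite exprn_gt0.
have -> : \sum_(u : 'rV[bit]_N) rsgn R (u 0 j) *
    (F (prefix j u + t) u - F (prefix j u + delta_mx 0 j + t) u) =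
    2 * \sum_(u : 'rV[bit]_N) Re (@sgn R (u 0 j) * \tr (D (prefix j u) *m eve u)).
  rewrite mulr_sumr; apply: eq_bigr => u _.
  rewrite re_sgn_mul mulrCA; congr (_ * _).
  rewrite /D -scalemxAl mxtraceZ reZ mulrA mulfV ?pnatr_eq0 // mul1r.
  by rewrite mulmxBl raddfB reD reN.
by rewrite ler_pM2l // -ler_pdivrMl.
Qed.

Lemma mutual_infoE : mutual_info state =
  (Re (\tr (state *m mxfun (@ln R) state)) -
   Re (\tr (tens (ptrace_r state) (ptrace_l state) *m
       mxfun (@ln R) (tens (ptrace_r state) (ptrace_l state))))) / ln 2.
Proof.
rewrite /mutual_info (entropyE posmx_wiretap_state.1).
rewrite (entropyE posmx_wiretap_bits.1) (entropyE posmx_wiretap_eve.1).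
rewrite [X in _ = (_ - X) / _](re_tr_ln_tens posmx_wiretap_bits posmx_wiretap_eve
  tr_wiretap_bits tr_wiretap_eve).
by rewrite mulrBl mulrDl opprK addrC opprD.
Qed.

(** The two signs of the absolute value use the continuity bound with the states in either order;
    the tests for one order are the negatives of those for the other. *)
Lemma mutual_info_bound (eps L : R) : 0 <= L ->
  \sum_(j in A) Num.sqrt (fidelity (synth_phase W j)) <= 2 * eps ->
  `|mutual_info state| * ln 2 <=
  eps * (2 + eps + L) +
  #|{: 'rV[bit]_#|A| * {ffun 'I_N -> E}}|%:R * expR (- L).
Proof.
move=> L0 He; have ln2 : (0 : R) < ln 2 by rewrite ln_gt0 // ltr1n.
rewrite mutual_infoE normrM normfV (gtr0_norm ln2) divfK ?gt_eqF //.
have prod0 := posmx_tens posmx_wiretap_bits posmx_wiretap_eve.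
have prod1 : Re (\tr (tens (ptrace_r state) (ptrace_l state))) = 1.
  rewrite tr_tens wiretap_bits mxtraceZ raddf_sum.
  rewrite (eq_bigr (fun=> 1)) ?average_1 ?mul1r ?tr_wiretap_eve // => u _.
  exact: tr_ketbra_ket.
rewrite ler_norml; apply/andP; split.
  rewrite lerNl opprB; apply: (ln_entropy_continuity prod0 posmx_wiretap_state
    prod1 tr_wiretap_state L0) => V Vc.
  rewrite -opprB mulmxN -mulNmx; apply: le_trans (test_bound _) He.
  exact: contractionN.
apply: (ln_entropy_continuity posmx_wiretap_state prod0
  tr_wiretap_state prod1 L0) => V Vc.
exact: le_trans (test_bound Vc) He.
Qed.

End Block.
End Secrecy.

Local Open Scope classical_set_scope.
Local Open Scope ring_scope.

(** * Asymptotics in the block length *)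

Section Asymptotics.
Variable R : realType.

Lemma powR2E (x : R) : 2 `^ x = expR (x * ln 2).
Proof. by rewrite /powR pnatr_eq0. Qed.

(** A single term of the exponential series, of degree at least [3 / beta], already grows as fast as
    [x ^+ 3]. *)
Lemma sqr_expR_powR_le (beta c : R) : 0 < beta -> 0 < c ->
  exists2 K, 0 < K & forall x, 1 <= x -> x ^+ 2 * expR (- (c * x `^ beta)) <= K / x.
Proof.
move=> beta0 c0; pose m := Num.bound (3 / beta).
have mb : 3 <= beta * m.+1%:R.
  have : 3 / beta < m%:R by apply: archi_boundP; rewrite divr_ge0 // ltW.
  rewrite ltr_pdivrMr // mulrC => /ltW H; apply: le_trans H _.
  by rewrite ler_pM2l // ler_nat.
have f0 : (0 : R) < m.+1`!%:R by rewrite ltr0n fact_gt0.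
have cm0 : 0 < c ^+ m.+1 by rewrite exprn_gt0.
exists (m.+1`!%:R / c ^+ m.+1) => [|x x1]; first by rewrite divr_gt0.
have x0 : 0 < x by rewrite (lt_le_trans _ x1).
have x30 : 0 < x ^+ 3 by rewrite exprn_gt0.
have H : c ^+ m.+1 * x ^+ 3 / m.+1`!%:R <= expR (c * x `^ beta).
  have := expR_ge1Dxn m (ltW (mulr_gt0 c0 (powR_gt0 beta x0))).
  apply: le_trans; rewrite exprMn -[(x `^ beta) ^+ _]powR_mulrn ?powR_ge0 //.
  rewrite -powRrM -(powR_mulrn 3 (ltW x0)).
  apply: (@le_trans _ _ (c ^+ m.+1 * x `^ (beta * m.+1%:R) / m.+1`!%:R)).
    by rewrite ler_pM2r ?invr_gt0 // ler_pM2l // ler_powR.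
  by rewrite lerDr.
have -> : m.+1`!%:R / c ^+ m.+1 / x = x ^+ 2 * (c ^+ m.+1 * x ^+ 3 / m.+1`!%:R)^-1.
  by field; rewrite !gt_eqF //= mulrn_eq0.
have p0 : 0 < c ^+ m.+1 * x ^+ 3 / m.+1`!%:R by rewrite divr_gt0 // mulr_gt0.
by rewrite ler_pM2l ?exprn_gt0 // expRN lef_pV2 ?posrE ?expR_gt0.
Qed.

(** Here [x = N], [q = 2^(-N^beta)], and [t] is the dimension term: the left side is the bound of
    [mutual_info_bound] at [eps = x q / 2] and [L = x a]. *)
Lemma leakage_arith (x q a t : R) : 1 <= x -> 0 < q -> q <= 1 -> 0 <= a -> t <= q ->
  x * q / 2 * (2 + x * q / 2 + x * a) + t <= (3 + a) * (x ^+ 2 * q).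
Proof.
move=> x1 q0 q1 a0 tq.
have xq : x * q <= x by rewrite ler_piMr // (le_trans ler01).
have x2 : 2 <= 2 * x by lra.
have x2q : q <= x ^+ 2 * q by rewrite ler_peMl ?exprn_ege1 // ltW.
have H : x * q / 2 * (2 + x * q / 2 + x * a) <= x * q / 2 * (2 * x + x / 2 + x * a).
  by rewrite ler_wpM2l; [lra | rewrite divr_ge0 // mulr_ge0; lra | lra].
apply: (le_trans (lerD H tq)).
have -> : x * q / 2 * (2 * x + x / 2 + x * a) = (5 / 4 + a / 2) * (x ^+ 2 * q).
  by field.
have x2q0 : 0 <= x ^+ 2 * q by rewrite (le_trans (ltW q0)).
have : 0 <= a * (x ^+ 2 * q) by rewrite mulr_ge0.
rewrite !mulrDl; lra.
Qed.

Lemma card_block_le (E : finType) k n : (k <= 2 ^ n)%N ->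
  (#|{: 'rV[bit]_k * {ffun 'I_(2 ^ n) -> E}}| <= (2 * #|E|.+1) ^ (2 ^ n))%N.
Proof.
move=> kn; rewrite card_prod card_mx mul1n card_ord card_ffun card_ord expnMn.
by rewrite leq_mul // ?leq_pexp2l // leq_exp2r // expn_gt0.
Qed.

(** The exponential is a power of [4 (D + 1)], twice the base of the dimension bound, which leaves
    [2^(-N)]. *)
Lemma dim_expR_le (d D N : nat) : (d <= (2 * D.+1) ^ N)%N ->
  d%:R * expR (- (N%:R * ln (4 * D.+1%:R))) <= 2 `^ (- N%:R) :> R.
Proof.
move=> dD; have D0 : (0 : R) < 4 * D.+1%:R by rewrite mulr_gt0.
rewrite expRN expRM_natl lnK ?posrE // powR_invn //.
rewrite ler_pdivrMr ?exprn_gt0 // -exprVn -exprMn.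
have -> : 2^-1 * (4 * D.+1%:R) = (2 * D.+1)%:R :> R by rewrite natrM; field.
by rewrite -natrX ler_nat.
Qed.

End Asymptotics.

Theorem theorem2 (R : realType) (B E S1 S2 : finType)
    (N : Op R bit -> Op R (B * E)) (U : Lin R bit (B * E * S2))
    (rho : bit -> Op R bit) (psi : bit -> Ket R (bit * S1)) (beta : R) :
  cptp N ->
  isometric_extension U N ->
  (forall z : bit, density (rho z)) ->
  (forall z : bit, purification (psi z) (rho z)) ->
  0 < beta < 2^-1 ->
  (fun n : nat =>
     mutual_info
       (wiretap_state (fun z : bit => channel_eve N (rho z))
          (info_set N U rho psi beta n)) : R^o) =o_\oo
  (fun n : nat => 2 `^ (- (2^-1 * (2 ^ n)%:R `^ beta)) : R^o).
Proof.
move=> Nc UN rho1 psi_rho /andP[beta0 beta1].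
have ln2 : (0 : R) < ln 2 by rewrite ln_gt0 // ltr1n.
pose a : R := ln (4 * #|E|.+1%:R).
have a0 : 0 <= a by rewrite ln_ge0 // -natrM ler1n muln_gt0.
(* The rate [ln 2 / 2] splits [2^(-N^beta)] into two equal factors: one absorbs [N^2] and leaves
   [K / N], the other is the claimed order. *)
have [K K0 HK] := sqr_expR_powR_le beta0 (divr_gt0 ln2 (ltr0n R 2)).
have bound n : `|mutual_info (wiretap_state (fun z => channel_eve N (rho z))
      (info_set N U rho psi beta n))| <=
    (3 + a) / ln 2 * (K / (2 ^ n)%:R) * 2 `^ (- (2^-1 * (2 ^ n)%:R `^ beta)).
  set A := info_set N U rho psi beta n; set x : R := (2 ^ n)%:R.
  set y := x `^ beta; set q : R := 2 `^ (- y).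
  have x1 : 1 <= x by rewrite ler1n expn_gt0.
  have x0 : 0 < x := lt_le_trans ltr01 x1.
  (* Since [beta < 1], the dimension term [2^(-N)] stays below [q]. *)
  have yx : y <= x by rewrite /y ler1_powR //; lra.
  have y0 : 0 <= y by rewrite powR_ge0.
  have q0 : 0 < q by rewrite powR_gt0.
  have q1 : q <= 1 by rewrite /q powR2E expR_le1 mulNr oppr_le0 mulr_ge0 // ltW.
  have HA : \sum_(j in A) Num.sqrt (fidelity (synth_phase (phase_bob U psi) j)) <=
      2 * (x * q / 2).
    rewrite mulrC divfK ?pnatr_eq0 //.
    apply: (@le_trans _ _ (\sum_(j in A) q)).
      by apply: ler_sum => j; rewrite !inE => /andP[_ /ltW].
    rewrite sumr_const -mulr_natl ler_pM2r // ler_nat.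
    by rewrite -[leqRHS]card_ord max_card.
  have xa0 : 0 <= x * a by rewrite mulr_ge0 // ltW.
  have := mutual_info_bound (phase_bobE U psi) (channel_eveE UN psi_rho)
    (fun z => tr_channel_eve Nc (rho1 z)) xa0 HA.
  set I := `|mutual_info _|; set d := #|_|%:R => H.
  have dL : d * expR (- (x * a)) <= q.
    apply: (@le_trans _ _ (2 `^ (- x))).
      apply: dim_expR_le; apply: card_block_le.
      by rewrite -[leqRHS]card_ord max_card.
    by rewrite ler_powR ?ler1n // lerN2.
  have {}H := le_trans H (leakage_arith x1 q0 q1 a0 dL).
  rewrite -(ler_pM2r ln2); apply: le_trans H _.
  have qq : q = expR (- (ln 2 / 2 * y)) * 2 `^ (- (2^-1 * y)).
    by rewrite /q !powR2E -expRD; congr expR; field.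
  rewrite qq [x ^+ 2 * _]mulrA mulrA.
  have -> : (3 + a) / ln 2 * (K / x) * 2 `^ (- (2^-1 * y)) * ln 2 =
            (3 + a) * (K / x) * 2 `^ (- (2^-1 * y)).
    by field; rewrite !gt_eqF.
  rewrite ler_pM2r ?powR_gt0 // ler_pM2l; first exact: HK.
  by rewrite ltr_wpDr.
apply/eqoP => e e0; rewrite near_simpl.
(* The prefactor is a constant over [2 ^ n], and [n < 2 ^ n], so it is at most [e] once [n] reaches
   this bound. *)
pose m := Num.bound ((3 + a) / ln 2 * K / e).
exists m => // n /= mn; apply: le_trans (bound n) _.
rewrite [X in _ <= _ * X]ger0_norm ?powR_ge0 // ler_pM2r ?powR_gt0 //.
have n0 : (0 : R) < (2 ^ n)%:R by rewrite ltr0n expn_gt0.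
rewrite mulrA ler_pdivrMr // [e * _]mulrC -ler_pdivrMr //.
have Km : (3 + a) / ln 2 * K / e < m%:R.
  apply: archi_boundP; rewrite divr_ge0 ?(ltW e0) // mulr_ge0 ?(ltW K0) //.
  by rewrite divr_ge0 ?(ltW ln2) // addr_ge0.
apply: le_trans (ltW Km) _; rewrite ler_nat (leq_trans mn) //.
by rewrite ltnW // ltn_expl.
Qed.
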